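(* For every positive integer $n$, the tight span $\mathbf{E}(\mathbb{S}^n)$ of the round sphere $\mathbb{S}^n$ is homeomorphic to the Hilbert cube $\mathfrak{H}=\prod_{k=1}^\infty\left[-\frac1k,\frac1k\right]\subseteq\ell^2$.
   Context: $\mathbb{S}^n$ denotes the $n$-dimensional unit sphere equipped with its geodesic (great-circle) metric. For a metric space $(X,d_X)$, let $\Delta(X)=\{f:X\to\mathbb{R}\text{ bounded}: f(x)+f(x')\ge d_X(x,x')\ \forall x,x'\in X\}$ and let the tight span $\mathbf{E}(X)$ be the set of minimal elements of $\Delta(X)$ (i.e. $f\in\Delta(X)$ such that $g\in\Delta(X)$, $g\le f$ pointwise implies $g=f$), endowed with the sup-norm metric. $\ell^2$ is the Hilbert space of square-summable real sequences, and $\mathfrak{H}$ carries the subspace topology. *)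

(* Defs.v *)
From HB Require Import structures.
From mathcomp Require Import all_boot all_order all_algebra.
From mathcomp Require Import all_classical all_reals all_analysis.
Set Implicit Arguments. Unset Strict Implicit. Unset Printing Implicit Defensive.
Import Order.TTheory GRing.Theory Num.Theory.
Import numFieldNormedType.Exports.
Local Open Scope classical_set_scope.
Local Open Scope ring_scope.

Definition sphere (R : realType) (n : nat) : Type :=
  {x : 'rV[R]_(n.+1) | \sum_(i < n.+1) x ord0 i ^+ 2 = 1}.

(* Geodesic (great-circle) distance on S^n: the angle between unit vectors. *)
Definition gdist (R : realType) (n : nat) (x y : sphere R n) : R :=
  acos (\sum_(i < n.+1) (sval x) ord0 i * (sval y) ord0 i).

Definition Delta (R : realType) (X : Type) (d : X -> X -> R) : set (X -> R) :=
  [set f | (exists M : R, forall x, `|f x| <= M) /\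
           (forall x x', d x x' <= f x + f x')].

Definition tight_span (R : realType) (X : Type) (d : X -> X -> R) : set (X -> R) :=
  [set f | Delta d f /\
           (forall g, Delta d g -> (forall x, g x <= f x) -> g = f)].

Definition supdist (R : realType) (X : Type) (f g : X -> R) : R :=
  sup (range (fun x => `|f x - g x|)).

(* Hilbert cube: prod_{k>=1} [-1/k, 1/k], indexed from 0 (entry k is the (k+1)-th). *)
Definition hilbert_cube (R : realType) : set (nat -> R) :=
  [set a | forall k : nat, `|a k| <= (k.+1%:R)^-1].

Definition l2dist (R : realType) (a b : nat -> R) : R :=
  Num.sqrt (limn (series (fun k => (a k - b k) ^+ 2))).

Definition metric_continuous (R : realType) (A B : Type)
  (dA : A -> A -> R) (dB : B -> B -> R) (S : set A) (f : A -> B) : Prop :=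
  forall x, S x -> forall e : R, 0 < e -> exists2 del : R, 0 < del &
    forall y, S y -> dA x y < del -> dB (f x) (f y) < e.

Definition homeomorphic (R : realType) (A B : Type)
  (S : set A) (dA : A -> A -> R) (T : set B) (dB : B -> B -> R) : Prop :=
  exists (f : A -> B) (g : B -> A),
    (forall x, S x -> T (f x)) /\
    (forall y, T y -> S (g y)) /\
    (forall x, S x -> g (f x) = x) /\
    (forall y, T y -> f (g y) = y) /\
    metric_continuous dA dB S f /\
    metric_continuous dB dA T g.

(* Main.v *)
(* For antipodal d, i.e. d x y + d x (-y) = D, the tight span consists of the
   1-Lipschitz functions f with f(x) + f(-x) = D.  Sampling f along a sequence of
   pairwise non-antipodal points that is dense up to sign identifies it with a
   compact convex symmetric subset of [-1,1]^N, as is the Hilbert cube; the claim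
   is thus a case of Keller's theorem, proved as follows for symmetric sets.
   With q a weighted sum of squares, y |-> y / (1 - q(y)) is a homeomorphism from
   a strictly convex K' onto K.  In a strictly convex body the fibre of the k-th
   coordinate over the earlier ones is an interval with continuous endpoints, and
   once a coordinate is extreme in its fibre all later ones are determined.
   Hence matching the ratios in which the coordinates divide their fibres is a
   homeomorphism between any two strictly convex bodies. *)
Require Import Defs.
From HB Require Import structures.
From mathcomp Require Import all_boot all_order all_algebra.
From mathcomp Require Import all_classical all_reals all_analysis.
From mathcomp Require Import ring lra.
Import Order.TTheory GRing.Theory Num.Theory.
Import numFieldNormedType.Exports.
Local Open Scope classical_set_scope.
Local Open Scope ring_scope.
Set Implicit Arguments.
Unset Strict Implicit.
Unset Printing Implicit Defensive.

(** * Symmetric convex bodies in the Hilbert cube *)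

Section Coordinates.
Variable R : realType.
Implicit Types (x y z v w : nat -> R) (K L B : set (nat -> R)).

(** The obstacle is the continuity of the fibre ends. Compactness makes the upper end upper
    semicontinuous, but over a boundary point of a projection of a general compact convex set it may
    jump down nearby. Strict convexity leaves two cases. Over an interior point, mixing in a little
    of a core point gives lower semicontinuity. Over a boundary point the fibre is a single point,
    and upper semicontinuity of the top together with lower semicontinuity of the bottom already
    forces convergence.

    Symmetry supplies a base point, since 0 lies in the core of every body, and it reduces lower
    ends to upper ends.

    The substitution y / (1 - q(y)) creates strict convexity because it sends a convex combination
    of y and z to a multiple of a convex combination of their images, with weights proportional to 1
    - q(y) and 1 - q(z). As 1 - q is strictly concave, that multiple has a factor strictly below 1
    when y and z differ.

    Everything runs on sequences with coordinatewise convergence. The two metrics enter only at the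
    end: on the Hilbert cube and on the tight span, metric convergence amounts to coordinatewise
    convergence. *)

Definition cube : set (nat -> R) := [set x | forall k, `|x k| <= 1].

(* Closed for coordinatewise convergence, stated with basic neighbourhoods. *)
Definition coord_closed K := forall x,
  (forall N e, 0 < e -> exists2 y, K y & forall j, (j < N)%N -> `|x j - y j| < e) ->
  K x.

(* Continuity along arbitrary filters: it composes freely and is equivalent to
   continuity on [K] for the product topology. *)
Definition coord_cont K (g : (nat -> R) -> R) :=
  forall (T : Type) (F : set_system T) (b : T -> nat -> R) x, Filter F ->
    K x -> (\forall t \near F, K (b t)) ->
    (forall j, b t j @[t --> F] --> x j) -> g (b t) @[t --> F] --> g x.

Lemma proj_cvg k (x : {ptws nat -> R}) :
  (fun y : {ptws nat -> R} => (y k : R)) @ x --> (x k : R).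
Proof. exact: (@proj_continuous nat (fun=> R) k x). Qed.

Lemma coord_closed_compact K : coord_closed K -> K `<=` cube ->
  compact (K : set {ptws nat -> R}).
Proof.
move=> cK Kc.
have cC : compact ([set f : {ptws nat -> R} | forall i : nat,
    (fun=> `[(-1 : R), 1]%classic) i (f i)]).
  exact: (@tychonoff nat (fun=> R) (fun=> `[(-1 : R), 1]%classic)
     (fun=> @segment_compact _ _ _)).
apply: (subclosed_compact _ cC); last first.
  by move=> x /Kc xc i /=; rewrite in_itv /= -ler_norml.
move=> x clx; apply: cK => N e e0.
have nb : nbhs (x : {ptws nat -> R})
    [set y : {ptws nat -> R} | forall j, (j < N)%N -> `|x j - y j| < e].
  elim: N => [|N IH]; first by apply: filterS filterT.
  have H : nbhs x [set y : {ptws nat -> R} | `|x N - y N| < e].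
    by move: (@proj_cvg N x) => /cvgrPdist_lt/(_ e e0).
  apply: filterS (filterI IH H) => y [H1 H2] j.
  by rewrite ltnS leq_eqVlt => /predU1P[->//|/H1].
by have [y [Ky Hy]] := clx _ nb; exists y.
Qed.

Lemma coord_max K (g : (nat -> R) -> R) : coord_closed K -> K `<=` cube ->
  K !=set0 -> coord_cont K g -> exists2 c, K c & forall x, K x -> g x <= g c.
Proof.
move=> cK Kc K0 cg.
have [|c] := @compact_EVT_max {ptws nat -> R} R g K K0 (coord_closed_compact cK Kc).
  apply/subspace_continuousP => x Kx.
  apply: cg => //.
    exact: withinT.
  by move=> j; apply: cvg_within_filter; exact: proj_cvg.
rewrite inE => Kc0 H; exists c => // x Kx; apply: H; rewrite inE //.
Qed.

Lemma coord_cont_proj K k : coord_cont K (fun x => x k).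
Proof. by move=> T F b x FF Kx Kb; apply. Qed.

Lemma coord_closed_lim K (b : nat -> nat -> R) y : coord_closed K ->
  (forall n, K (b n)) -> (forall n j, (j < n)%N -> y j = b n j) -> K y.
Proof.
move=> cK Kb yb; apply: cK => N e e0; exists (b N) => // j jN.
by rewrite (yb N) // subrr normr0.
Qed.

Definition convex_set K := forall x y l, K x -> K y -> 0 <= l <= 1 ->
  K (fun k => l * x k + (1 - l) * y k).

Definition symmetric_set K := forall x, K x -> K (fun k => - x k).

(** A triangular form of infinite-dimensionality: with the earlier coordinates held at 0, coordinate
    [k] can still move, so no fibre over 0 degenerates. *)
Definition staircase K := forall k, exists2 v, K v &
  (forall j, (j < k)%N -> v j = 0) /\ 0 < v k.

Definition body K := [/\ coord_closed K, K `<=` cube, convex_set K,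
  symmetric_set K & staircase K].

(** Subsets of the cube have empty interior in the product topology, because a basic neighbourhood
    leaves all but finitely many coordinates free. Room around a point is therefore measured by a
    small multiple of the body itself. *)
Definition core K : set (nat -> R) :=
  [set x | exists2 eta, 0 < eta & forall v, K v -> K (fun k => x k + eta * v k)].

Definition strictly_convex K := forall x y l, K x -> K y -> x <> y -> 0 < l < 1 ->
  core K (fun k => l * x k + (1 - l) * y k).

Definition agree k x y := forall j, (j < k)%N -> x j = y j.

Lemma agree_sym k x y : agree k x y -> agree k y x.
Proof. by move=> H j /H. Qed.

Lemma agree_trans k x y z : agree k x y -> agree k y z -> agree k x z.
Proof. by move=> H1 H2 j jk; rewrite H1 // H2. Qed.

Lemma agreeS k x y : agree k x y -> x k = y k -> agree k.+1 x y.
Proof. by move=> H e j; rewrite ltnS leq_eqVlt => /predU1P[->|/H]. Qed.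

Lemma agreeW j k x y : (j <= k)%N -> agree k x y -> agree j x y.
Proof. by move=> jk H i ij; apply: H; apply: leq_trans jk. Qed.

Lemma body0 K : body K -> K (fun=> 0).
Proof.
case=> _ _ cK sK /(_ 0%N)[v Kv _].
have -> : (fun=> 0) = (fun k => 2^-1 * v k + (1 - 2^-1) * - v k).
  by apply/funext => k; lra.
by apply: cK => //; [exact: sK|lra].
Qed.

Lemma body_scale K x l : body K -> K x -> 0 <= l <= 1 -> K (fun k => l * x k).
Proof.
move=> bK Kx l01; have K0 := body0 bK; case: bK => _ _ cK _ _.
have -> : (fun k => l * x k) = (fun k => l * x k + (1 - l) * 0).
  by apply/funext => k; rewrite mulr0 addr0.
exact: cK.
Qed.

Lemma core_sub K x : body K -> core K x -> K x.
Proof.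
move=> bK [eta e0 /(_ _ (body0 bK))].
by congr K; apply/funext => k; rewrite mulr0 addr0.
Qed.

Lemma core0 K : body K -> core K (fun=> 0).
Proof.
move=> bK; exists 1 => // v; congr K; apply/funext => k.
by rewrite mul1r add0r.
Qed.

(** * Fibres of a coordinate over the earlier ones *)

Section Fibres.
Variable B : set (nat -> R).
Hypothesis bB : body B.
Hypothesis sB : strictly_convex B.

Let clB : coord_closed B. Proof. by case: bB. Qed.
Let cubeB : B `<=` cube. Proof. by case: bB. Qed.
Let symB : symmetric_set B. Proof. by case: bB. Qed.
Let stairB : staircase B. Proof. by case: bB. Qed.

Definition top k x : R := sup [set w k | w in [set w | B w /\ agree k w x]].
(** By symmetry the fibre over [- x] is the negative of the fibre over [x], so facts about lower
    ends are read off from upper ends. *)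
Definition bot k x : R := - top k (fun j => - x j).

Lemma top_max k x : B x -> exists w, [/\ B w, agree k w x &
  forall v, B v -> agree k v x -> v k <= w k].
Proof.
move=> Bx.
have [||||w [Bw wx] H] :=
    @coord_max [set w | B w /\ agree k w x] (fun w => w k).
- move=> y Hy; split.
    by apply: clB => N e e0; have [z [Bz _] Hz] := Hy N e e0; exists z.
  move=> j jk; apply/eqP; rewrite -subr_eq0 -normr_le0; apply/ler_addgt0Pr => e e0.
  have [z [Bz zx] /(_ j)] := Hy k e e0.
  by rewrite jk (zx j jk) add0r => /(_ isT)/ltW.
- by move=> y [/cubeB].
- by exists x; split => // j.
- exact: coord_cont_proj.
by exists w; split => // v Bv vx; apply: H.
Qed.

Lemma top_attained k x : B x -> exists w, [/\ B w, agree k w x & w k = top k x].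
Proof.
move=> Bx; have [w [Bw wx H]] := top_max k Bx; exists w; split => //.
apply/eqP; rewrite eq_le; apply/andP; split.
  apply: ub_le_sup; last by exists w.
  by exists (w k) => _ [v [Bv vx] <-]; apply: H.
apply: ge_sup; first by exists (w k), w.
by move=> _ [v [Bv vx] <-]; apply: H.
Qed.

Lemma top_ge k x v : B v -> agree k v x -> v k <= top k x.
Proof.
move=> Bv vx; apply: ub_le_sup; last by exists v.
by exists 1 => _ [w [/cubeB/(_ k) + _] <-]; rewrite ler_norml => /andP[].
Qed.

Lemma top_agree k x y : agree k x y -> top k x = top k y.
Proof.
move=> xy; rewrite /top; congr (sup (image _ _)); apply/seteqP.
split=> w /= [Bw H]; split => //; first by apply: (agree_trans H).
by apply: (agree_trans H); exact: agree_sym.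
Qed.

Lemma agreeN k x y : agree k x y -> agree k (fun j => - x j) (fun j => - y j).
Proof. by move=> H j /H ->. Qed.

Lemma bot_agree k x y : agree k x y -> bot k x = bot k y.
Proof. by move=> /agreeN/top_agree; rewrite /bot => ->. Qed.

Lemma bot_attained k x : B x -> exists w, [/\ B w, agree k w x & w k = bot k x].
Proof.
move=> /symB/(top_attained k)[w [Bw wx wk]]; exists (fun j => - w j); split.
- exact: symB.
- by move=> j jk; rewrite wx // opprK.
- by rewrite wk.
Qed.

Lemma bot_le k x v : B v -> agree k v x -> bot k x <= v k.
Proof.
move=> Bv vx; rewrite /bot lerNl.
by apply: (@top_ge k _ (fun j => - v j)) => //; [exact: symB|exact: agreeN].
Qed.

(** For a body this says that the first [k] coordinates of [x] form an interior point of the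
    projection of [B] to these coordinates. *)
Definition inner k x := exists2 z, core B z & agree k z x.

Lemma inner0 x : inner 0 x.
Proof. by exists (fun=> 0); first exact: core0. Qed.

Lemma innerW k x : inner k.+1 x -> inner k x.
Proof. by move=> [z cz zx]; exists z => //; apply: agreeW zx. Qed.

(** The room around a core point is spent along plus and minus a staircase vector, which moves
    coordinate [k] and none before it. *)
Lemma core_between k z x : core B z -> agree k z x -> bot k x < z k < top k x.
Proof.
move=> [eta e0 He] zx; have [v Bv [v0 vk]] := stairB k.
have Bv' := symB Bv; have evk := mulr_gt0 e0 vk; apply/andP; split.
  apply: le_lt_trans (@bot_le k x _ (He _ Bv') _) _.
    by move=> j jk; rewrite v0 // oppr0 mulr0 addr0 zx.
  lra.
apply: lt_le_trans (@top_ge k x _ (He _ Bv) _).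
  lra.
by move=> j jk; rewrite v0 // mulr0 addr0 zx.
Qed.

(** A nondegenerate fibre has two distinct end points, and by strict convexity their midpoint is in
    the core. *)
Lemma innerP k x : B x -> inner k x <-> bot k x < top k x.
Proof.
move=> Bx; split=> [[z cz zx]|bt].
  by have /andP[] := core_between cz zx; apply: lt_trans.
have [w [Bw wx wk]] := top_attained k Bx.
have [w' [Bw' wx' wk']] := bot_attained k Bx.
exists (fun j => 2^-1 * w j + (1 - 2^-1) * w' j).
  apply: sB => //; last by lra.
  by move=> ww; move: bt; rewrite -wk -wk' ww ltxx.
by move=> j jk; rewrite wx // wx' //; lra.
Qed.

(* The converse is where strict convexity enters: an extreme coordinate pins
   down all the later ones. *)
Lemma innerSP k x : B x -> inner k.+1 x <-> bot k x < x k < top k x.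
Proof.
move=> Bx; split=> [[z cz zx]|/andP[bx xt]].
  by rewrite -(zx k) //; apply: core_between => //; apply: agreeW zx.
have [w [Bw wx wk]] := top_attained k Bx.
have [w' [Bw' wx' wk']] := bot_attained k Bx.
pose l := (x k - bot k x) / (top k x - bot k x).
have d0 : 0 < top k x - bot k x by lra.
have l01 : 0 < l < 1 by rewrite /l divr_gt0 ?ltr_pdivrMr //=; lra.
exists (fun j => l * w j + (1 - l) * w' j).
  apply: sB => //.
  by move=> ww; move: d0; rewrite -wk -wk' ww subrr ltxx.
apply: agreeS => [j jk|]; first by rewrite wx // wx' //; lra.
by rewrite wk wk' /l; field; lra.
Qed.

End Fibres.
End Coordinates.

(** * Continuity of the fibre ends *)

Section StrictBodies.
Variable R : realType.
Implicit Types (x y z v w : nat -> R) (K L B : set (nat -> R)).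

Lemma body_scaleN K x l : body K -> K x -> `|l| <= 1 -> K (fun k => l * x k).
Proof.
move=> bK Kx l1; have [l0|l0] := leP 0 l.
  by apply: body_scale => //; rewrite l0 /=; move: l1; rewrite ger0_norm.
have sK : symmetric_set K by case: bK.
have -> : (fun k => l * x k) = (fun k => - l * - x k).
  by apply/funext => k; rewrite mulrNN.
apply: body_scale => //; first exact: sK.
by move: l1; rewrite ltr0_norm // => ->; rewrite andbT oppr_ge0 ltW.
Qed.

Lemma body_comb K x y a b : body K -> K x -> K y -> `|a| <= 2^-1 -> `|b| <= 2^-1 ->
  K (fun k => a * x k + b * y k).
Proof.
move=> bK Kx Ky a2 b2; have cK : convex_set K by case: bK.
have -> : (fun k => a * x k + b * y k) =
    (fun k => 2^-1 * (2 * a * x k) + (1 - 2^-1) * (2 * b * y k)).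
  by apply/funext => k; field.
apply: cK; last by lra.
- by apply: body_scaleN => //; rewrite normrM ger0_norm //; lra.
- by apply: body_scaleN => //; rewrite normrM ger0_norm //; lra.
Qed.

(** The projection of [eta * B] to finitely many coordinates is a neighbourhood of 0. By induction
    the earlier entries are matched by some [v']; a multiple of a staircase vector then corrects
    coordinate [k] without disturbing them. *)
Lemma small_prefix B k eta : body B -> 0 < eta ->
  exists2 del, 0 < del & forall d : nat -> R,
    (forall j, (j < k)%N -> `|d j| < del) ->
    exists2 v, B v & forall j, (j < k)%N -> eta * v j = d j.
Proof.
move=> bB; elim: k eta => [|k IH] eta e0.
  by exists 1 => // d _; exists (fun=> 0); first exact: body0.
have [s Bs [s0 sk]] : exists2 v, B v & (forall j, (j < k)%N -> v j = 0) /\ 0 < v k.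
  by case: bB => _ _ _ _ /(_ k).
have s1 : s k <= 1.
  by case: bB => _ /(_ _ Bs)/(_ k) + _ _ _; rewrite ler_norml => /andP[].
have es : 0 < eta * s k by rewrite mulr_gt0.
have e4 : 0 < eta * s k / 4 by rewrite divr_gt0.
(* The quarter keeps both coefficients used below, [s k / 4] and [c], within 1/2, as [body_comb]
   demands. *)
have [del d0 Hd] := IH _ e4.
exists (Num.min del (eta * s k / 4)); first by rewrite lt_min d0.
move=> d dd; have [j jk|v' Bv' Hv'] := Hd d.
  by have := dd j (ltnW jk); rewrite lt_min => /andP[].
pose c := (d k - eta * s k / 4 * v' k) / (eta * s k).
have ne : eta != 0 by rewrite gt_eqF.
have ns : s k != 0 by rewrite gt_eqF.
have v1 : `|v' k| <= 1 by case: bB => _ /(_ _ Bv')/(_ k).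
exists (fun j => s k / 4 * v' j + c * s j).
  apply: body_comb => //.
    by rewrite ger0_norm; lra.
  rewrite /c normrM normfV (gtr0_norm es) ler_pdivrMr //.
  have := dd k (ltnSn k); rewrite lt_min => /andP[_ dk].
  have : `|eta * s k / 4 * v' k| <= eta * s k / 4.
    by rewrite normrM (gtr0_norm e4) ler_piMr // ltW.
  have := ler_normB (d k) (eta * s k / 4 * v' k).
  by move: dk; set A := `|_|; set A' := `|_|; set A'' := `|_|; lra.
move=> j; rewrite ltnS leq_eqVlt => /predU1P[->|jk].
  by rewrite /c; field; rewrite ne ns.
by rewrite (s0 j jk) -(Hv' j jk); field.
Qed.

Lemma near_prefix (T : Type) (F : set_system T) (b : T -> nat -> R) y k e :
  Filter F -> 0 < e -> (forall j, (j < k)%N -> b t j @[t --> F] --> y j) ->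
  \forall t \near F, forall j, (j < k)%N -> `|y j - b t j| < e.
Proof.
move=> FF e0; elim: k => [_|k IH H]; first by apply: nearW.
have H1 : \forall t \near F, `|y k - b t k| < e.
  by move: (H k (ltnSn k)) => /cvgrPdist_lt; apply.
have H2 := IH (fun j jk => H j (ltnW jk)).
apply: filterS2 H1 H2 => t H1 H2 j.
by rewrite ltnS leq_eqVlt => /predU1P[->|/H2].
Qed.

Section Continuity.
Variable B : set (nat -> R).
Hypotheses (bB : body B) (sB : strictly_convex B).

(** The points of [B] whose coordinate [k] is at least [top B k y + e] form a compact set; none of
    them agrees with [y] up to [k], so their prefixes stay at a positive distance from that of
    [y]. *)
Lemma top_usc k y e : B y -> 0 < e -> exists2 del, 0 < del & forall x, B x ->
  (forall j, (j < k)%N -> `|y j - x j| < del) -> top B k x < top B k y + e.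
Proof.
move=> By e0; have [clB cubeB _ _ _] := bB.
pose C := [set w | B w /\ top B k y + e <= w k].
have [C0|/set0P C0] := eqVneq C set0.
  exists 1 => // x Bx _; have [w [Bw _ <-]] := top_attained bB k Bx.
  by rewrite ltNge; apply/negP => H; suff : set0 w by []; rewrite -C0.
pose g w := - \sum_(j < k) `|w j - y j|.
have [||//||c [Bc ck] gc] := @coord_max R C g.
- move=> x Hx; split.
    by apply: clB => N d d0; have [w [Bw _] Hw] := Hx N d d0; exists w.
  apply/ler_addgt0Pl => d d0; have [w [Bw wk] /(_ k)] := Hx k.+1 d d0.
  by rewrite ltnSn ltr_distlC => /(_ isT)/andP[_]; lra.
- by move=> w [/cubeB].
- move=> T F b x FF _ _ bx; apply: cvgN; apply: cvg_big => [|j _].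
    by move=> ? ?; apply: add_continuous.
  apply: cvg_norm; apply: cvgB; [exact: bx|exact: cvg_cst].
have gc0 : g c < 0.
  rewrite /g oppr_lt0 lt_neqAle sumr_ge0 // andbT; apply/negP.
  rewrite eq_sym psumr_eq0 // => /allP H.
  suff /(top_ge bB Bc) : agree k c y by lra.
  move=> j jk; apply/eqP; rewrite -subr_eq0 -normr_eq0.
  by apply: (H (Ordinal jk)); rewrite mem_index_enum.
(* With [k.+1] in the denominator, [k] such terms add up to strictly less than [- g c]. *)
exists (- g c / k.+1%:R); first by rewrite divr_gt0 // oppr_gt0.
move=> x Bx Hx; have [w [Bw wx <-]] := top_attained bB k Bx.
rewrite ltNge; apply/negP => wk; have /gc : C w by [].
apply/negP; rewrite -ltNge /g ltrNr.
apply: (@le_lt_trans _ _ (\sum_(j < k) (- g c / k.+1%:R))).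
  by apply: ler_sum => j _; rewrite wx // distrC ltW // Hx.
rewrite sumr_const card_ord -[ltLHS]mulr_natr.
rewrite -mulrA -[ltRHS]mulr1 ltr_pM2l ?oppr_gt0 //.
by rewrite mulrC ltr_pdivrMr // mul1r ltr_nat.
Qed.

(** A point attaining the top over [y] is mixed with a small share [s] of a core point over [y]. The
    room around the core point absorbs the change of prefix from [y] to [x], and coordinate [k]
    drops only by a multiple of [s]. *)
Lemma top_lsc k y e : B y -> inner B k y -> 0 < e ->
  exists2 del, 0 < del & forall x, B x ->
  (forall j, (j < k)%N -> `|y j - x j| < del) -> top B k y - e < top B k x.
Proof.
move=> By [z [eta eta0 cz] zy] e0; have [_ cubeB cB _ _] := bB.
have [w [Bw wy <-]] := top_attained bB k By.
(* All entries are at most 1 in absolute value, so the mixture lowers coordinate [k] by at most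
   [3 * s], which is below [e]. *)
pose s := Num.min 2^-1 (e / 4).
have [s0 s2 se] : [/\ 0 < s, s <= 2^-1 & s <= e / 4].
  by rewrite /s lt_min ge_min lexx ge_min lexx orbT; split => //; lra.
(* [m <= eta] keeps [m / eta * v] in [B], and [m <= 1] bounds its effect on coordinate [k]. *)
pose m := Num.min 1 eta.
have [m0 m1 me] : [/\ 0 < m, m <= 1 & m <= eta].
  by rewrite /m lt_min ge_min lexx ge_min lexx orbT; split => //; lra.
have sm0 : 0 < s * m by rewrite mulr_gt0.
have [del d0 Hd] := small_prefix k bB sm0.
exists del => // x Bx yx.
have [j jk|v Bv Hv] := Hd (fun j => x j - y j); first by rewrite distrC yx.
have Bv' : B (fun j => m / eta * v j).
  apply: body_scaleN => //; rewrite ger0_norm; first by rewrite ler_pdivrMr // mul1r.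
  by rewrite divr_ge0 // ltW.
have Bz : B z by apply: core_sub => //; exists eta.
pose u j := s * (z j + eta * (m / eta * v j)) + (1 - s) * w j.
have Bu : B u by apply: cB => //; [exact: cz|lra].
have ux : agree k u x.
  move=> j jk; have := Hv j jk; rewrite /u wy // zy //.
  have -> : eta * (m / eta * v j) = m * v j by field; lra.
  by rewrite mulrDr [s * (m * _)]mulrA => ->; ring.
apply: lt_le_trans (top_ge bB Bu ux); rewrite /u.
have -> : eta * (m / eta * v k) = m * v k by field; lra.
have /ler_normlP[z1 z2] := cubeB _ Bz k.
have /ler_normlP[w1 w2] := cubeB _ Bw k.
have /ler_normlP[v1 v2] := cubeB _ Bv k.
have : -1 <= m * v k by nra.
by set q := m * v k; nra.
Qed.

(** Where [y] is not inner its fibre is a point, and the lower bound comes from the other end: [top]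
    at [x] is at least [bot] at [x], which by [top_usc] at [- y] exceeds [bot] at [y], equal to
    [top] at [y], minus [e]. *)
Lemma top_cvg (T : Type) (F : set_system T) (b : T -> nat -> R) k y : Filter F ->
  B y -> (\forall t \near F, B (b t)) ->
  (forall j, (j < k)%N -> b t j @[t --> F] --> y j) ->
  top B k (b t) @[t --> F] --> top B k y.
Proof.
move=> FF By Bb bj; apply/cvgrPdist_lt => e e0.
have symB : symmetric_set B by case: bB.
have [d1 d10 H1] := top_usc k By e0.
have [d2 d20 H2] : exists2 del, 0 < del & forall x, B x ->
    (forall j, (j < k)%N -> `|y j - x j| < del) -> top B k y - e < top B k x.
  have [iy|niy] := pselect (inner B k y); first exact: top_lsc.
  have [d2 d20 H2] := top_usc k (symB _ By) e0.
  exists d2 => // x Bx xy.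
  have : top B k y <= bot B k y.
    by rewrite leNgt; apply/negP => /(innerP bB sB k By).
  have := le_trans (bot_le (k:=k) bB Bx (fun j _ => erefl))
    (top_ge bB Bx (fun j _ => erefl)).
  suff : top B k (fun j => - x j) < top B k (fun j => - y j) + e.
    by rewrite /bot; lra.
  apply: (H2 _ (symB _ Bx)) => j jk.
  by rewrite (_ : - y j - - x j = - (y j - x j)) ?normrN ?xy //; ring.
have d0 : 0 < Num.min d1 d2 by rewrite lt_min d10.
have := near_prefix FF d0 bj.
apply: filterS2 Bb => t Bb Hb.
rewrite distrC ltr_distl; apply/andP; split.
  by apply: H2 => // j /Hb; rewrite lt_min => /andP[].
by apply: H1 => // j /Hb; rewrite lt_min => /andP[].
Qed.

Lemma bot_cvg (T : Type) (F : set_system T) (b : T -> nat -> R) k y : Filter F ->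
  B y -> (\forall t \near F, B (b t)) ->
  (forall j, (j < k)%N -> b t j @[t --> F] --> y j) ->
  bot B k (b t) @[t --> F] --> bot B k y.
Proof.
move=> FF By Bb bj; have symB : symmetric_set B by case: bB.
apply: cvgN; apply: (@top_cvg T F (fun t j => - b t j)) => //.
- exact: symB.
- by apply: filterS Bb => t; apply: symB.
- by move=> j jk; apply: cvgN; apply: bj.
Qed.

End Continuity.
End StrictBodies.

(** * Homeomorphism of strictly convex bodies *)

Section Matching.
Variable R : realType.
Implicit Types (x y z v w : nat -> R) (K L B : set (nat -> R)).

Definition coord_homeo K L := exists f g : (nat -> R) -> nat -> R,
  [/\ forall x, K x -> L (f x), forall y, L y -> K (g y),
      forall x, K x -> g (f x) = x & forall y, L y -> f (g y) = y] /\
  (forall k, coord_cont K (fun x => f x k)) /\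
  (forall k, coord_cont L (fun y => g y k)).

Lemma coord_homeo_sym K L : coord_homeo K L -> coord_homeo L K.
Proof. by move=> [f [g [[fK gL gf fg] [cf cg]]]]; exists g, f. Qed.

Lemma coord_cont_comp K L (f : (nat -> R) -> nat -> R) g :
  (forall x, K x -> L (f x)) -> (forall k, coord_cont K (fun x => f x k)) ->
  coord_cont L g -> coord_cont K (g \o f).
Proof.
move=> fL cf cg T F b x FF Kx Kb bx.
apply: (@cg T F (fun t => f (b t)) (f x)) => //; first exact: fL.
- by apply: filterS Kb => t; apply: fL.
- by move=> j; apply: cf.
Qed.

Lemma coord_homeo_trans K L B :
  coord_homeo K L -> coord_homeo L B -> coord_homeo K B.
Proof.
move=> [f [g [[fK gL gf fg] [cf cg]]]] [f' [g' [[fK' gL' gf' fg'] [cf' cg']]]].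
exists (f' \o f), (g \o g'); split; first split.
- by move=> x /fK/fK'.
- by move=> y /gL'/gL.
- by move=> x Kx /=; rewrite gf' ?gf //; apply: fK.
- by move=> y By /=; rewrite fg ?fg' //; apply: gL'.
by split=> k; [exact: coord_cont_comp (cf' k)|exact: coord_cont_comp (cg k)].
Qed.

(* [x k] and [y k] divide their fibres [bot, top] in the same ratio. *)
Definition matched_at B L k x y :=
  (x k - bot B k x) * (top L k y - y k) = (y k - bot L k y) * (top B k x - x k).

Definition matched B L x y := forall k, matched_at B L k x y.

Lemma matched_sym B L x y : matched B L x y -> matched L B y x.
Proof. by move=> H k; rewrite /matched_at H. Qed.

Lemma bot_self_le K k x : body K -> K x -> bot K k x <= x k.
Proof. by move=> bK Kx; apply: bot_le. Qed.

Lemma top_self_ge K k x : body K -> K x -> x k <= top K k x.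
Proof. by move=> bK Kx; apply: top_ge. Qed.

Lemma not_inner_eq K k x : body K -> strictly_convex K -> K x -> ~ inner K k x ->
  bot K k x = x k /\ top K k x = x k.
Proof.
move=> bK sK Kx nx; have tb : top K k x <= bot K k x.
  by rewrite leNgt; apply/negP => /(innerP bK sK k Kx).
have := bot_self_le k bK Kx; have := top_self_ge k bK Kx.
by move=> h1 h2; split; lra.
Qed.

(** Over a degenerate fibre [matched_at] is void, so fibres must be shown to degenerate
    simultaneously. As long as both fibres are proper, a coordinate strictly inside one is matched
    by a coordinate strictly inside the other, and [innerSP] passes this on to the next index. *)
Lemma matched_inner B L k x y : body B -> strictly_convex B ->
  body L -> strictly_convex L -> B x -> L y -> matched B L x y ->
  inner B k x -> inner L k y.
Proof.
move=> bB sB bL sL Bx Ly xy; elim: k => [|k IH] ix; first exact: inner0.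
have /(innerP bL sL k Ly) iy := IH (innerW ix).
move: ix => /(innerSP bB sB k Bx)/andP[x1 x2].
apply/(innerSP bL sL k Ly).
have := xy k; rewrite /matched_at => e.
have y1 := bot_self_le k bL Ly; have y2 := top_self_ge k bL Ly.
move: e; set a := x k - _; set b := top B k x - _ => e.
have a0 : 0 < a by rewrite /a; lra.
have b0 : 0 < b by rewrite /b; lra.
rewrite !lt_neqAle y1 y2 !andbT; apply/andP; split; apply/eqP => E.
  move: e; rewrite E subrr mul0r => /eqP; rewrite mulf_eq0 !subr_eq0; lra.
move: e; rewrite -E subrr mulr0 => /esym/eqP; rewrite mulf_eq0 !subr_eq0; lra.
Qed.

Section Pair.
Variables B L : set (nat -> R).
Hypotheses (bB : body B) (sB : strictly_convex B).
Hypotheses (bL : body L) (sL : strictly_convex L).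

Lemma matched_formula k x y : inner B k x -> B x -> matched_at B L k x y ->
  y k = ((x k - bot B k x) * top L k y + (top B k x - x k) * bot L k y) /
        (top B k x - bot B k x).
Proof.
move=> ix Bx; move: ix => /(innerP bB sB k Bx) bt; rewrite /matched_at => H.
apply: (@mulIf _ (top B k x - bot B k x)); first lra.
by rewrite divfK; [nra|lra].
Qed.

(** Coordinate by coordinate: over a proper fibre of [x] the ratio determines the entry, and
    otherwise the fibres of [y] and [y'] are the same single point. *)
Lemma matched_unique x y y' : B x -> L y -> L y' ->
  matched B L x y -> matched B L x y' -> y = y'.
Proof.
move=> Bx Ly Ly' xy xy'.
suff H k : agree k y y' by apply/funext => k; apply: (H k.+1).
elim: k => [//|k IH]; apply: agreeS => //.
have tt := top_agree L IH; have bb := bot_agree L IH.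
have [ix|nix] := pselect (inner B k x).
  by rewrite (matched_formula ix Bx (xy k)) (matched_formula ix Bx (xy' k)) tt bb.
have nin u : L u -> matched B L x u -> ~ inner L k u.
  by move=> Lu xu iu; apply: nix; apply: (matched_inner bL sL bB sB Lu Bx) iu;
    apply: matched_sym.
have [_ <-] := not_inner_eq bL sL Ly (nin _ Ly xy).
by have [_ <-] := not_inner_eq bL sL Ly' (nin _ Ly' xy').
Qed.

Lemma matched_step k x b : B x -> L b ->
  exists b', [/\ L b', agree k b' b & matched_at B L k x b'].
Proof.
move=> Bx Lb; have [ix|nix] := pselect (inner B k x); last first.
  exists b; split => //; rewrite /matched_at.
  by have [-> ->] := not_inner_eq bB sB Bx nix; rewrite !subrr mul0r mulr0.
have [w [Lw wb wk]] := top_attained bL k Lb.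
have [w' [Lw' wb' wk']] := bot_attained bL k Lb.
move: ix => /(innerP bB sB k Bx) bt.
have x1 := bot_self_le k bB Bx; have x2 := top_self_ge k bB Bx.
pose l := (x k - bot B k x) / (top B k x - bot B k x).
have cL : convex_set L by case: bL.
pose u j := l * w j + (1 - l) * w' j.
have ub : agree k u b by move=> j jk; rewrite /u wb // wb' //; ring.
exists u; split => //.
  apply: cL => //; apply/andP; split; first by rewrite divr_ge0 //; lra.
  by rewrite /l ler_pdivrMr; lra.
rewrite /matched_at (top_agree L ub) (bot_agree L ub) /u wk wk' /l.
by field; lra.
Qed.

Lemma matched_at_agree k x y y' : agree k.+1 y y' ->
  matched_at B L k x y -> matched_at B L k x y'.
Proof.
move=> yy; rewrite /matched_at -(yy k (ltnSn k)).
by rewrite (top_agree L (agreeW (leqnSn k) yy)) (bot_agree L (agreeW (leqnSn k) yy)).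
Qed.

Lemma matched_exists x : B x -> exists2 y, L y & matched B L x y.
Proof.
move=> Bx.
have /choice[f Hf] : forall kb : nat * (nat -> R), exists b', L kb.2 ->
    [/\ L b', agree kb.1 b' kb.2 & matched_at B L kb.1 x b'].
  move=> [k b] /=; have [Lb|nLb] := pselect (L b); last by exists b.
  by have [b' Hb'] := matched_step k Bx Lb; exists b'.
pose b := fix b n := if n is m.+1 then f (m, b m) else (fun=> 0).
have Lb n : L (b n).
  by elim: n => [|n IH]; [exact: body0|case: (Hf (n, b n) IH)].
have step n : agree n (b n.+1) (b n) by case: (Hf (n, b n) (Lb n)).
have ab n m : agree n (b (m + n)%N) (b n).
  elim: m => [|m IH] //; rewrite addSn.
  by apply: agree_trans IH; apply: agreeW (step _); rewrite leq_addl.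
(* Step [k] settles coordinate [k] and later steps preserve it, hence the index [k.+1]. *)
pose y k := b k.+1 k.
have yb n : agree n y (b n).
  move=> j jn; rewrite /y -(ab j.+1 (n - j.+1)%N) ?ltnSn //.
  by rewrite subnK.
exists y.
  by apply: (coord_closed_lim (b := b)) => //; case: bL.
move=> k; apply: (@matched_at_agree k x (b k.+1)).
  exact/agree_sym/yb.
by case: (Hf (k, b k) (Lb k)).
Qed.

End Pair.

Lemma strict_homeo B L : body B -> strictly_convex B -> body L -> strictly_convex L ->
  coord_homeo B L.
Proof.
have ex K M : body K -> strictly_convex K -> body M -> strictly_convex M ->
    exists f : (nat -> R) -> nat -> R,
    [/\ forall x, K x -> M (f x), forall x, K x -> matched K M x (f x) &
        forall k, coord_cont K (fun x => f x k)].
  move=> bK sK bM sM.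
  have /choice[f Hf] : forall x, exists y, K x -> M y /\ matched K M x y.
    move=> x; have [Kx|nKx] := pselect (K x); last by exists x.
    by have [y My xy] := matched_exists bK sK bM Kx; exists y.
  have fM x : K x -> M (f x) by move=> /Hf[].
  have fm x : K x -> matched K M x (f x) by move=> /Hf[].
  exists f; split => // k T F b x FF Kx Kb bx.
  (* The fibre ends of [f x] depend only on its earlier entries, so their convergence follows from
     the induction hypothesis. In a proper fibre the ratio formula is continuous; in a degenerate
     one its denominator vanishes, and the entry is squeezed between two ends with the same
     limit. *)
  elim/ltn_ind: k => k IH.
  have Mfb : \forall t \near F, M (f (b t)) by apply: filterS Kb => t /fM.
  have ctop := top_cvg bM sM FF (fM _ Kx) Mfb IH.
  have cbot := bot_cvg bM sM FF (fM _ Kx) Mfb IH.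
  have [ix|nix] := pselect (inner K k x); last first.
    have nfx : ~ inner M k (f x).
      move=> ifx; apply: nix.
      by apply: (matched_inner bM sM bK sK (fM _ Kx) Kx) ifx;
        apply: matched_sym; apply: fm.
    have [eb et] := not_inner_eq bM sM (fM _ Kx) nfx.
    rewrite et in ctop; rewrite eb in cbot.
    apply: squeeze_cvgr cbot ctop; apply: filterS Mfb => t Mt.
    by rewrite bot_self_le // top_self_ge.
  have dtop := top_cvg bK sK FF Kx Kb (fun j _ => bx j) (k := k).
  have dbot := bot_cvg bK sK FF Kx Kb (fun j _ => bx j) (k := k).
  have /(innerP bK sK k Kx) bt := ix.
  rewrite (matched_formula bK sK ix Kx (fm _ Kx k)).
  have gap : \forall t \near F, 0 < top K k (b t) - bot K k (b t).
    by apply: (cvgr_gt (top K k x - bot K k x)); [exact: cvgB|lra].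
  apply: (@cvg_trans _ (((b t k - bot K k (b t)) * top M k (f (b t)) +
      (top K k (b t) - b t k) * bot M k (f (b t))) /
      (top K k (b t) - bot K k (b t)) @[t --> F])).
    apply: near_eq_cvg; apply: filterS2 gap Kb => t g0 Kt.
    rewrite -matched_formula //; first by apply/innerP => //; lra.
    exact: fm.
  apply: cvgM; last by apply: cvgV; [lra|exact: cvgB].
  by apply: cvgD; apply: cvgM => //; apply: cvgB.
move=> bB sB bL sL.
have [f [fL fm cf]] := ex _ _ bB sB bL sL.
have [g [gB gm cg]] := ex _ _ bL sL bB sB.
exists f, g; split=> //; split => //.
- move=> x Bx; apply: (matched_unique bL sL bB sB (fL _ Bx)) => //.
  + exact/gB/fL.
  + exact/gm/fL.
  + exact/matched_sym/fm.
- move=> y Ly; apply: (matched_unique bB sB bL sL (gB _ Ly)) => //.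
  + exact/fL/gB.
  + exact/fm/gB.
  + exact/matched_sym/gm.
Qed.

End Matching.

(** * Series dominated by inverse squares *)

Section InverseSquareSeries.
Variable R : realType.
Implicit Types (c : nat -> R) (C : R).

Definition inv_sq (k : nat) : R := k.+1%:R^-1 ^+ 2.

(** A common majorant makes tails uniformly small, so sums pass to coordinatewise limits. This
    serves both the quadratic form [quad] and the squared distance on the Hilbert cube. *)
Definition sq_dominated C c := forall k, `|c k| <= C * inv_sq k.

Lemma inv_sq_ge0 k : 0 <= inv_sq k. Proof. exact: sqr_ge0. Qed.

Lemma inv_sq_gt0 k : 0 < inv_sq k.
Proof. by rewrite exprn_gt0 // invr_gt0. Qed.

Lemma inv_sq_le1 k : inv_sq k <= 1.
Proof. by rewrite expr_le1 // ?invr_ge0 // invf_le1 // ler1n. Qed.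

(* Telescoping: [1/(k+1)^2 <= 1/k - 1/(k+1)]. *)
Lemma inv_sq_tail N m :
  \sum_(N.+1 <= k < N.+1 + m) inv_sq k <= N.+1%:R^-1 - (N.+1 + m)%:R^-1.
Proof.
elim: m => [|m IH]; first by rewrite addn0 big_geq // subrr.
rewrite addnS big_nat_recr ?leq_addr //=; apply: le_trans (lerD IH (lexx _)) _.
rewrite /inv_sq -[(N.+1 + m).+1%:R]natr1.
have : 0 < (N.+1 + m)%:R :> R by rewrite ltr0n.
set a := (N.+1 + m)%:R => a0.
have e : a^-1 - (a + 1)^-1 - (a + 1)^-1 ^+ 2 = a^-1 * (a + 1)^-1 ^+ 2.
  by field; rewrite !gt_eqF //; lra.
have : 0 <= a^-1 * (a + 1)^-1 ^+ 2 by rewrite mulr_ge0 ?sqr_ge0 // invr_ge0 ltW.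
rewrite -e; move: (a^-1) ((a + 1)^-1) (N.+1%:R^-1) => u v t; lra.
Qed.

Lemma dominated_tail C c N m : sq_dominated C c ->
  `|\sum_(N.+1 <= k < N.+1 + m) c k| <= C / N.+1%:R.
Proof.
move=> dc; have C0 : 0 <= C.
  by have := le_trans (normr_ge0 _) (dc 0%N); rewrite pmulr_lge0 // inv_sq_gt0.
apply: le_trans (ler_norm_sum _ _ _) _.
apply: le_trans (ler_sum _ (fun k _ => dc k)) _.
rewrite -mulr_sumr ler_wpM2l //; apply: le_trans (inv_sq_tail N m) _.
by rewrite gerBl invr_ge0.
Qed.

Lemma dominated_cvg C c : sq_dominated C c -> cvgn (series c).
Proof.
move=> dc; have C0 : 0 <= C.
  by have := le_trans (normr_ge0 _) (dc 0%N); rewrite pmulr_lge0 // inv_sq_gt0.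
apply: normed_cvg.
apply: (@series_le_cvg _ _ (fun k => C * inv_sq k)) => [k|k|k|].
- exact: normr_ge0.
- by rewrite mulr_ge0 // inv_sq_ge0.
- exact: dc.
apply: nondecreasing_is_cvgn.
  by apply/nondecreasing_series => k _ _; rewrite mulr_ge0 // inv_sq_ge0.
(* The first term is at most [C], and the terms from index 1 on are bounded by [dominated_tail] at
   [N = 0]. *)
exists (C + C / 1%:R) => _ [n _ <-].
have dd : sq_dominated C (fun k => C * inv_sq k).
  by move=> k; rewrite ger0_norm // mulr_ge0 // inv_sq_ge0.
case: n => [|n]; first by rewrite /series /= big_geq // divr1 addr_ge0.
rewrite /series /= big_nat_recl // -{1}[C in leRHS]mulr1 lerD //.
  by rewrite ler_wpM2l // inv_sq_le1.
have := dominated_tail 0 n dd; apply: le_trans.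
by rewrite add1n big_add1 /=; apply: ler_norm.
Qed.

Lemma dominated_lim_tail C c N : sq_dominated C c ->
  `|limn (series c) - series c N.+1| <= C / N.+1%:R.
Proof.
move=> dc; have cc := dominated_cvg dc.
have lim : `|series c n - series c N.+1| @[n --> \oo] -->
    `|limn (series c) - series c N.+1|.
  by apply: cvg_norm; apply: cvgB => //; exact: cvg_cst.
apply: (cvgr_to_le lim).
exists N.+1 => // n /= Nn.
by rewrite sub_series_geq // -(subnKC Nn); apply: dominated_tail.
Qed.

Lemma dominated_lim_le C c : sq_dominated C c -> `|limn (series c)| <= 2 * C.
Proof.
move=> dc; have := dominated_lim_tail 0 dc.
rewrite /series /= big_nat1 divr1 => H.
have := dc 0%N; rewrite /inv_sq invr1 expr1n mulr1 => H0.
have := ler_normD (limn (series c) - c 0%N) (c 0%N); rewrite subrK; lra.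
Qed.

Lemma dist_le_tails (a a' s s' d e : R) : `|a - s| <= d -> `|a' - s'| <= d ->
  `|s - s'| <= e / 2 -> d <= e / 4 -> `|a - a'| <= e.
Proof.
by rewrite !ler_norml => /andP[h1 h2] /andP[h3 h4] /andP[h5 h6] h7; lra.
Qed.

(** Dominated convergence: both series are cut where their tails are below [e / 4], and the
    remaining finite sum converges termwise. *)
Lemma dominated_lim_cvg C c0 (T : Type) (F : set_system T) (c : T -> nat -> R) :
  Filter F -> sq_dominated C c0 -> (\forall t \near F, sq_dominated C (c t)) ->
  (forall k, c t k @[t --> F] --> c0 k) ->
  limn (series (c t)) @[t --> F] --> limn (series c0).
Proof.
move=> FF d0 dc ck; apply/cvgrPdist_le => e e0.
have C0 : 0 <= C.
  by have := le_trans (normr_ge0 _) (d0 0%N); rewrite pmulr_lge0 // inv_sq_gt0.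
have [N HN] : exists N, C / N.+1%:R <= e / 4.
  exists (Num.bound (C / (e / 4))); rewrite ler_pdivrMr // -ler_pdivrMl; last lra.
  rewrite mulrC; apply: le_trans (ltW (archi_boundP _)) _.
    by rewrite divr_ge0 //; lra.
  by rewrite ler_nat.
have cN : series (c t) N.+1 @[t --> F] --> series c0 N.+1.
  rewrite /series /=; apply: cvg_big => [|j _]; last exact: ck.
  by move=> ? ?; apply: add_continuous.
have e2 : 0 < e / 2 by lra.
move/cvgrPdist_le : cN => /(_ _ e2); apply: filterS2 dc => t dt Ht.
have H1 := dominated_lim_tail N d0; have H2 := dominated_lim_tail N dt.
exact: dist_le_tails H1 H2 Ht HN.
Qed.

Lemma dominated_lim_comb C D c d (a b : R) : sq_dominated C c -> sq_dominated D d ->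
  limn (series (fun k => a * c k + b * d k)) =
  a * limn (series c) + b * limn (series d).
Proof.
move=> /dominated_cvg cc /dominated_cvg dd; apply/cvg_lim => //.
have -> : series (fun k => a * c k + b * d k) =
    (fun n => a * series c n + b * series d n).
  by apply/funext => n; rewrite /series /= big_split /= !mulr_sumr.
by apply: cvgD; (apply: cvgM; [exact: cvg_cst|]).
Qed.

Lemma dominated_lim_ge C c k : sq_dominated C c -> (forall j, 0 <= c j) ->
  c k <= limn (series c).
Proof.
move=> dc c0; have cc := dominated_cvg dc.
apply: (@le_trans _ _ (series c k.+1)).
  by rewrite /series /= big_nat_recr //= lerDr sumr_ge0.
apply: nondecreasing_cvgn_le => //.
by apply/nondecreasing_series => j _ _.
Qed.

End InverseSquareSeries.

(** * Strictly convex models and Keller's theorem *)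

Section Strictification.
Variable R : realType.
Implicit Types (x y z v w : nat -> R) (K L B : set (nat -> R)).

Lemma coord_closed_cvg K (T : Type) (F : set_system T) (b : T -> nat -> R) x :
  coord_closed K -> ProperFilter F -> (\forall t \near F, K (b t)) ->
  (forall j, b t j @[t --> F] --> x j) -> K x.
Proof.
move=> cK FF Kb bx; apply: cK => N e e0.
have H := near_prefix (k := N) (@filter_filter _ _ FF) e0 (fun j _ => bx j).
by have [t [Kt Ht]] := filter_ex (filterI Kb H); exists (b t).
Qed.

(** Sequences suffice since there are countably many coordinates: the [n]-th approximant is taken
    close on the first [n] of them. *)
Lemma coord_closed_seq K : (forall (b : nat -> nat -> R) x, (forall n, K (b n)) ->
  (forall j, b n j @[n --> \oo] --> x j) -> K x) -> coord_closed K.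
Proof.
move=> H x Hx.
have /choice[b Hb] : forall n, exists y, K y /\
    forall j, (j < n)%N -> `|x j - y j| < n.+1%:R^-1.
  by move=> n; have [|y Ky Hy] := Hx n n.+1%:R^-1; [rewrite invr_gt0|exists y].
apply: (H b) => [n|j]; first by case: (Hb n).
apply/cvgrPdist_lt => e e0.
exists (maxn j.+1 (Num.bound e^-1)) => // n /=; rewrite geq_max => /andP[jn en].
case: (Hb n) => _ /(_ j jn) /lt_trans; apply.
rewrite invf_plt ?posrE //; apply: lt_le_trans (archi_boundP _) _.
  by rewrite invr_ge0 ltW.
by rewrite ler_nat ltnW.
Qed.

Lemma coord_closed_preimage K L (f : (nat -> R) -> nat -> R) :
  coord_closed K -> coord_closed L -> (forall k, coord_cont K (fun x => f x k)) ->
  coord_closed [set x | K x /\ L (f x)].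
Proof.
move=> cK cL cf; apply: coord_closed_seq => b x Kb bx.
have Kx : K x.
  by apply: coord_closed_cvg cK _ _ bx; apply: nearW => n; case: (Kb n).
split=> //; apply: (coord_closed_cvg (F := \oo) (b := fun n => f (b n)) cL).
  by apply: nearW => n; case: (Kb n).
by move=> k; apply: (cf k) => //; apply: nearW => n; case: (Kb n).
Qed.

Lemma cube_closed : coord_closed (@cube R).
Proof.
apply: coord_closed_seq => b x cb bx k.
apply: (cvgr_to_le (cvg_norm (bx k))).
by apply: nearW => n; apply: cb.
Qed.

(** The factor 1/4 makes [quad] at most 1/2 on the cube, so [1 - quad y] stays away from 0. The
    summable positive weights make [quad] continuous for coordinatewise convergence and still
    strictly convex. *)
Definition quad x : R := limn (series (fun k => 4^-1 * inv_sq R k * x k ^+ 2)).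

Lemma quad_dominated C x : (forall k, `|x k| <= C) ->
  sq_dominated (4^-1 * C ^+ 2) (fun k => 4^-1 * inv_sq R k * x k ^+ 2).
Proof.
move=> xC k; rewrite normrM ger0_norm ?mulr_ge0 ?inv_sq_ge0 // mulrAC.
rewrite ler_wpM2r ?inv_sq_ge0 // ler_wpM2l // normrX lerXn2r ?nnegrE //.
exact: le_trans (xC k).
Qed.

Lemma quad_term_ge0 x k : 0 <= 4^-1 * inv_sq R k * x k ^+ 2.
Proof. by rewrite mulr_ge0 ?sqr_ge0 // mulr_ge0 // inv_sq_ge0. Qed.

Lemma quad_cube x : cube x -> 0 <= quad x <= 2^-1.
Proof.
move=> /quad_dominated dx; apply/andP; split.
  exact: le_trans (quad_term_ge0 x 0) (dominated_lim_ge 0 dx (quad_term_ge0 x)).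
apply: le_trans (ler_norm _) _; apply: le_trans (dominated_lim_le dx) _.
by rewrite expr1n; lra.
Qed.

Lemma quadZ r x : cube x -> quad (fun k => r * x k) = r ^+ 2 * quad x.
Proof.
move=> /quad_dominated dx; have := dominated_lim_comb (r ^+ 2) 0 dx dx.
rewrite mul0r addr0 => <-; rewrite /quad; congr (limn (series _)).
by apply/funext => k; ring.
Qed.

Lemma quadN x : quad (fun k => - x k) = quad x.
Proof.
rewrite /quad; congr (limn (series _)).
by apply/funext => k; rewrite sqrrN.
Qed.

(** The exact convexity defect of a quadratic form; it is the source of all strictness below. *)
Lemma quad_comb y z l : cube y -> cube z ->
  cube (fun k => l * y k + (1 - l) * z k) ->
  quad (fun k => l * y k + (1 - l) * z k) + l * (1 - l) * quad (fun k => y k - z k) =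
  l * quad y + (1 - l) * quad z.
Proof.
move=> cy cz /quad_dominated dw.
have /quad_dominated dd : forall k, `|y k - z k| <= 2.
  by move=> k; apply: le_trans (ler_normB _ _) _; have := cy k; have := cz k; lra.
rewrite -(dominated_lim_comb _ _ (quad_dominated cy) (quad_dominated cz)).
rewrite -[X in X + _]mul1r -(dominated_lim_comb _ _ dw dd).
congr (limn (series _)); apply/funext => k; ring.
Qed.

Lemma quad_diff_gt0 y z : cube y -> cube z -> y <> z ->
  0 < quad (fun k => y k - z k).
Proof.
move=> cy cz yz.
have /quad_dominated dd : forall k, `|y k - z k| <= 2.
  by move=> k; apply: le_trans (ler_normB _ _) _; have := cy k; have := cz k; lra.
have [k yzk] : exists k, y k != z k.
  apply: contrapT => H; apply: yz; apply/funext => k.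
  by apply/eqP/negPn/negP => yzk; apply: H; exists k.
apply: lt_le_trans (dominated_lim_ge k dd (quad_term_ge0 _)).
apply: mulr_gt0; first by rewrite mulr_gt0 ?inv_sq_gt0.
by rewrite lt_neqAle sqr_ge0 andbT eq_sym sqrf_eq0 subr_eq0.
Qed.

Lemma quad_cont : coord_cont (@cube R) quad.
Proof.
move=> T F b x FF cx cb bx.
apply: (dominated_lim_cvg (C := 4^-1 * 1 ^+ 2)); first exact: quad_dominated.
  by apply: filterS cb => t; apply: quad_dominated.
by move=> k; apply: cvgM; [exact: cvg_cst|rewrite expr2; apply: cvgM; exact: bx].
Qed.

Lemma coord_cont_sub K L g : K `<=` L -> coord_cont L g -> coord_cont K g.
Proof.
move=> KL cg T F b x FF Kx Kb bx; apply: (cg T F) => //; first exact: KL.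
by apply: filterS Kb => t; apply: KL.
Qed.

Definition inflate y k : R := y k / (1 - quad y).
Definition deflate x k : R := 2 / (1 + Num.sqrt (1 + 4 * quad x)) * x k.
(** Membership in the cube is what keeps the denominator of [inflate] positive. *)
Definition strictify K : set (nat -> R) := [set y | cube y /\ K (inflate y)].

Lemma inflate_cont k : coord_cont (@cube R) (fun y => inflate y k).
Proof.
move=> T F b x FF cx cb bx.
apply: cvgM; [exact: bx|apply: cvgV; first by have := quad_cube cx; lra].
by apply: cvgB; [exact: cvg_cst|exact: quad_cont].
Qed.

Lemma deflate_cont k : coord_cont (@cube R) (fun x => deflate x k).
Proof.
move=> T F b x FF cx cb bx; apply: cvgM; last exact: bx.
apply: cvgM; first exact: cvg_cst.
apply: cvgV.
  by apply: lt0r_neq0; rewrite ltr_pwDl // sqrtr_ge0.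
apply: cvgD; first exact: cvg_cst.
apply: (cvg_comp (fun t => 1 + 4 * quad (b t)) (@Num.sqrt R)); last first.
  exact: sqrt_continuous.
apply: cvgD; first exact: cvg_cst.
by apply: cvgM; [exact: cvg_cst|exact: quad_cont].
Qed.

(* The factor [r] of [deflate] is the positive root of [r^2 q + r = 1]. *)
Lemma deflate_factor q : 0 <= q -> let r := 2 / (1 + Num.sqrt (1 + 4 * q)) in
  0 < r <= 1 /\ 1 - r ^+ 2 * q = r :> R.
Proof.
move=> q0 /=; have s0 := sqrtr_ge0 (1 + 4 * q).
have q1 : 0 <= 1 + 4 * q by lra.
have := sqr_sqrtr q1; set s := Num.sqrt _ in s0 * => es.
have s1 : 1 <= s by rewrite -(@ler_pXn2r _ 2) ?nnegrE // es expr1n; lra.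
have p0 : 0 < 1 + s by lra.
split; first by rewrite divr_gt0 // ler_pdivrMr //=; lra.
have -> : q = (s ^+ 2 - 1) / 4 by rewrite es; field.
by field; lra.
Qed.

Lemma inflate_deflate x : cube x -> cube (deflate x) /\ inflate (deflate x) = x.
Proof.
move=> cx; have /andP[q0 q2] := quad_cube cx.
have [/andP[r0 r1] e] := deflate_factor q0.
split=> [k|].
  by rewrite normrM (ger0_norm (ltW r0)) mulr_ile1 // ltW.
by apply/funext => k; rewrite /inflate /deflate quadZ // e mulrAC divff ?mul1r //.
Qed.

Lemma deflate_inflate y : cube y -> cube (inflate y) -> deflate (inflate y) = y.
Proof.
move=> cy ci; have /andP[q0 q2] := quad_cube cy.
have iE : inflate y = (fun k => (1 - quad y)^-1 * y k).
  by apply/funext => k; rewrite mulrC.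
have t0 : 1 - quad y != 0 by lra.
apply/funext => k; rewrite /deflate {1}iE quadZ //.
have -> : 1 + 4 * ((1 - quad y)^-1 ^+ 2 * quad y) =
    ((1 + quad y) / (1 - quad y)) ^+ 2 by field.
rewrite sqrtr_sqr ger0_norm; last by rewrite divr_ge0 //; lra.
by rewrite /inflate; field; rewrite t0 /=; apply/eqP; lra.
Qed.

(** [w / s] is the convex combination of [inflate y] and [inflate z] with weights
    [l * (1 - quad y) / s] and [(1 - l) * (1 - quad z) / s]. Since [inflate w] is [w / s] scaled by
    [s / (1 - quad w)], the last equation tells how far it is pulled towards 0. *)
Lemma inflate_comb K y z l w s : body K -> strictify K y -> strictify K z ->
  0 <= l <= 1 -> w = (fun k => l * y k + (1 - l) * z k) ->
  s = l * (1 - quad y) + (1 - l) * (1 - quad z) ->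
  [/\ cube w, 2^-1 <= s <= 1, K (fun k => w k / s) &
      1 - quad w = s + l * (1 - l) * quad (fun k => y k - z k)].
Proof.
move=> bK [cy Ky] [cz Kz] /andP[l0 l1] wE sE.
have cw : cube w.
  move=> k; rewrite wE; apply: le_trans (ler_normD _ _) _; rewrite !normrM.
  rewrite (ger0_norm l0) (ger0_norm (_ : 0 <= 1 - l)); last lra.
  by have := cy k; have := cz k; nra.
have /andP[qy0 qy2] := quad_cube cy; have /andP[qz0 qz2] := quad_cube cz.
have s12 : 2^-1 <= s <= 1 by rewrite sE; nra.
have s0 : s != 0 by lra.
split => //; last by move: cw; rewrite wE => /(quad_comb cy cz); rewrite sE; lra.
have -> : (fun k => w k / s) = (fun k => (l * (1 - quad y) / s) * inflate y k +
    (1 - l * (1 - quad y) / s) * inflate z k).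
  apply/funext => k; rewrite wE /inflate.
  have -> : 1 - l * (1 - quad y) / s = (1 - l) * (1 - quad z) / s.
    by rewrite -[X in X - _ = _](divff s0) -mulrBl; congr (_ / _); rewrite sE; ring.
  by field; rewrite s0 /=; apply/andP; split; lra.
have cK : convex_set K by case: bK.
apply: cK => //; have s00 : 0 < s by lra.
rewrite divr_ge0 /=; [|nra|lra].
by rewrite ler_pdivrMr // sE; nra.
Qed.

Lemma strictify_body K : body K -> body (strictify K).
Proof.
move=> bK; have [clK cubeK cK sK stK] := bK; split.
- by apply: coord_closed_preimage => //; [exact: cube_closed|exact: inflate_cont].
- by move=> y [].
- move=> y z l Sy Sz l01.
  have [w wE] : exists w, w = fun k => l * y k + (1 - l) * z k by eexists.
  have [s sE] : exists s, s = l * (1 - quad y) + (1 - l) * (1 - quad z) by eexists.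
  have [cw s12 Kw qw] := inflate_comb bK Sy Sz l01 wE sE.
  rewrite -wE; split => //; have s0 : s != 0 by lra.
  have /andP[q0 q2] := quad_cube cw.
  have /andP[d0 _] : 0 <= quad (fun k => y k - z k) <= 2.
    apply/andP; split; last first.
      have /quad_dominated dd : forall k, `|y k - z k| <= 2.
        move=> k; apply: le_trans (ler_normB _ _) _.
        by have := Sy.1 k; have := Sz.1 k; lra.
      apply: le_trans (ler_norm _) _; apply: le_trans (dominated_lim_le dd) _.
      by lra.
    have [->|yz] := pselect (y = z); last first.
      by rewrite ltW // quad_diff_gt0 //; [case: Sy|case: Sz].
    rewrite (_ : (fun k => _) = (fun k => 0 * z k)); last first.
      by apply/funext => k; rewrite subrr mul0r.
    by rewrite quadZ ?expr0n ?mul0r //; case: Sz.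
  have -> : inflate w = (fun k => s / (1 - quad w) * (w k / s)).
    by apply/funext => k; rewrite /inflate; field; rewrite s0 /=; lra.
  apply: body_scale => //; have w0 : 0 < 1 - quad w by lra.
  rewrite divr_ge0 /=; [|lra|lra].
  by rewrite ler_pdivrMr // mul1r qw lerDl mulr_ge0 // mulr_ge0 //; lra.
- move=> y [cy Ky]; split => [k|]; first by rewrite normrN.
  rewrite (_ : inflate _ = (fun k => - inflate y k)); first exact: sK.
  by apply/funext => k; rewrite /inflate quadN mulNr.
- move=> k; have [v Kv [v0 vk]] := stK k.
  have [cd id] := inflate_deflate (cubeK _ Kv).
  have /andP[q0 q2] := quad_cube (cubeK _ Kv).
  have [/andP[r0 r1] e] := deflate_factor q0.
  exists (deflate v); first by split => //; rewrite id.
  split=> [j jk|]; first by rewrite /deflate v0 // mulr0.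
  by rewrite /deflate mulr_gt0.
Qed.

(** The slack left by the convexity defect allows [w] to be stretched by a factor [1 + e] within the
    body. A point that can be stretched lies in the core, by convexity with any other point [v]. *)
Lemma strictify_strict K : body K -> strictly_convex (strictify K).
Proof.
move=> bK y z l Sy Sz yz /andP[l0 l1].
have l01 : 0 <= l <= 1 by rewrite !ltW.
have [w wE] : exists w, w = fun k => l * y k + (1 - l) * z k by eexists.
have [s sE] : exists s, s = l * (1 - quad y) + (1 - l) * (1 - quad z) by eexists.
have [cw s12 Kw] := inflate_comb bK Sy Sz l01 wE sE; rewrite -wE.
have := quad_diff_gt0 Sy.1 Sz.1 yz; move: {yz wE} Sy Sz => _ _.
have [clK cubeK cK sK stK] := bK.
move: (quad (fun k => y k - z k)) => d d0 qw.
have /andP[q0 q2] := quad_cube cw.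
pose g := l * (1 - l) * d.
have g0 : 0 < g by rewrite /g !mulr_gt0 //; lra.
rewrite -/g in qw.
(* Stretching raises [s + quad w = 1 - g] by [e * s + (2 * e + e ^+ 2) * quad w], which is at most
   [3 * e] because [s <= 1], [quad w <= 2^-1] and [e <= 1]. *)
pose e := g / 3.
have e0 : 0 < e by rewrite /e; lra.
have e1 : e <= 1 by rewrite /e; lra.
have key : (1 + e) * s <= 1 - (1 + e) ^+ 2 * quad w.
  have -> : quad w = 1 - s - g by lra.
  have -> : g = 3 * e by rewrite /e; field.
  nra.
have Sw : strictify K (fun k => (1 + e) * w k).
  have s0 : 0 < s by lra.
  split=> [k|].
    have := cubeK _ Kw k; rewrite normrM normfV (gtr0_norm s0) ler_pdivrMr // mul1r.
    by move=> wk; rewrite normrM gtr0_norm; nra.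
  have k0 : 0 < 1 - (1 + e) ^+ 2 * quad w by nra.
  have -> : inflate (fun k => (1 + e) * w k) =
      (fun k => (1 + e) * s / (1 - (1 + e) ^+ 2 * quad w) * (w k / s)).
    by apply/funext => k; rewrite /inflate quadZ //; field; rewrite !gt_eqF.
  apply: body_scale => //; rewrite divr_ge0 /=; [|nra|nra].
  by rewrite ler_pdivrMr // mul1r.
have cS : convex_set (strictify K) by case: (strictify_body bK).
exists (e / (1 + e)); first by rewrite divr_gt0 //; lra.
move=> v Sv.
have -> : (fun k => w k + e / (1 + e) * v k) =
   (fun k => (1 + e)^-1 * ((1 + e) * w k) + (1 - (1 + e)^-1) * v k).
  by apply/funext => k; field; lra.
apply: cS => //; rewrite invr_ge0 invf_le1; lra.
Qed.

Lemma strictify_homeo K : body K -> coord_homeo K (strictify K).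
Proof.
move=> bK; have [_ cubeK _ _ _] := bK; exists deflate, inflate; split; first split.
- by move=> x Kx; have [cd id] := inflate_deflate (cubeK _ Kx); split; rewrite ?id.
- by move=> y [].
- by move=> x /cubeK/inflate_deflate[].
- by move=> y [cy /cubeK]; apply: deflate_inflate.
split=> k.
  by apply: (@coord_cont_sub _ (@cube R)) => //; exact: deflate_cont.
by apply: (@coord_cont_sub _ (@cube R)) => [y []//|]; exact: inflate_cont.
Qed.

Theorem body_homeo K L : body K -> body L -> coord_homeo K L.
Proof.
move=> bK bL; apply: coord_homeo_trans (strictify_homeo bK) _.
apply: coord_homeo_trans (coord_homeo_sym (strictify_homeo bL)).
by apply: strict_homeo; [exact: strictify_body|exact: strictify_strict|
  exact: strictify_body|exact: strictify_strict].
Qed.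

End Strictification.

(** * Metric continuity through filters, and the Hilbert cube as a body *)

Section MetricFilters.
Variable R : realType.

(** The distances are bare functions on bare types; this filter lets the continuity results for
    [coord_cont] apply to them, without any metric axiom. *)
Definition metric_nbhs (A : Type) (dA : A -> A -> R) (S : set A) (x : A) : set_system A :=
  filter_from [set e : R | 0 < e] (fun e => [set y | S y /\ dA x y < e]).

Lemma metric_nbhs_filter (A : Type) (dA : A -> A -> R) (S : set A) x :
  Filter (metric_nbhs dA S x).
Proof.
apply: filter_from_filter; first by exists 1 => /=.
move=> e e' /= e0 e'0; exists (Num.min e e'); first by rewrite /= lt_min e0.
by move=> y /= [Sy]; rewrite lt_min => /andP[].
Qed.

Lemma metric_nbhs_in (A : Type) (dA : A -> A -> R) (S : set A) x :
  \forall y \near metric_nbhs dA S x, S y.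
Proof. by exists 1 => //= y []. Qed.

Lemma metric_nbhs_cvg (A : Type) (dA : A -> A -> R) (S : set A) x (g : A -> R) :
  (forall y, S y -> `|g x - g y| <= dA x y) -> g y @[y --> metric_nbhs dA S x] --> g x.
Proof.
move=> H; have FF := metric_nbhs_filter dA S x.
apply/cvgrPdist_lt => e e0; exists e => //= y [Sy]; apply: le_lt_trans.
exact: H.
Qed.

Lemma metric_continuous_cvg (A B : Type) (dA : A -> A -> R) (dB : B -> B -> R)
    (S : set A) (f : A -> B) :
  (forall x, S x -> dB (f x) (f y) @[y --> metric_nbhs dA S x] --> 0) ->
  metric_continuous dA dB S f.
Proof.
move=> H x Sx e e0; have FF := metric_nbhs_filter dA S x.
move: (H x Sx) => /cvgrPdist_lt/(_ e e0)[del /= d0 Hd].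
exists del => // y Sy xy; have := Hd y (conj Sy xy).
by rewrite /= sub0r normrN => /(le_lt_trans (ler_norm _)).
Qed.

Lemma hilbert_cube_body : body (@hilbert_cube R).
Proof.
split.
- apply: coord_closed_seq => b x hb bx k.
  apply: (cvgr_to_le (cvg_norm (bx k))).
  by apply: nearW => n; apply: hb.
- by move=> x hx k; apply: le_trans (hx k) _; rewrite invf_le1 // ler1n.
- move=> x y l hx hy /andP[l0 l1] k.
  apply: le_trans (ler_normD _ _) _; rewrite !normrM.
  rewrite (ger0_norm l0) (ger0_norm (_ : 0 <= 1 - l)); last lra.
  by have := hx k; have := hy k; move: (k.+1%:R^-1) => t; nra.
- by move=> x hx k; rewrite normrN.
- move=> k; exists (fun j => if j == k then k.+1%:R^-1 else 0).
    move=> j; case: eqP => [->|_]; first by rewrite ger0_norm.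
    by rewrite normr0.
  split=> [j jk|]; first by rewrite ltn_eqF.
  by rewrite eqxx invr_gt0.
Qed.

Lemma l2_dominated (a b : nat -> R) : hilbert_cube a -> hilbert_cube b ->
  sq_dominated 4 (fun k => (a k - b k) ^+ 2).
Proof.
move=> ha hb k; rewrite normrX /inv_sq.
have -> : 4 * k.+1%:R^-1 ^+ 2 = (2 * k.+1%:R^-1) ^+ 2 :> R by ring.
rewrite lerXn2r ?nnegrE ?mulr_ge0 //.
apply: le_trans (ler_normB _ _) _; have := ha k; have := hb k.
by move: (k.+1%:R^-1) => t; lra.
Qed.

Lemma l2dist_coord (a b : nat -> R) k : hilbert_cube a -> hilbert_cube b ->
  `|a k - b k| <= l2dist a b.
Proof.
move=> ha hb; rewrite -sqrtr_sqr /l2dist; apply: ler_wsqrtr.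
by apply: (dominated_lim_ge k (l2_dominated ha hb)) => j; apply: sqr_ge0.
Qed.

Lemma l2dist_cvg (T : Type) (F : set_system T) (b : T -> nat -> R) a : Filter F ->
  hilbert_cube a -> (\forall t \near F, hilbert_cube (b t)) ->
  (forall k, b t k @[t --> F] --> a k) -> l2dist a (b t) @[t --> F] --> 0.
Proof.
move=> FF ha hb ba; rewrite -(sqrtr0 R).
apply: (cvg_comp (fun t => limn (series (fun k => (a k - b t k) ^+ 2))) (@Num.sqrt R));
  last exact: sqrt_continuous.
have -> : 0 = limn (series (fun k => (a k - a k) ^+ 2)).
  apply/esym/cvg_lim => //; rewrite (_ : series _ = fun=> 0); first exact: cvg_cst.
  by apply/funext => n; rewrite /series /= big1 // => k _; rewrite subrr expr0n.
apply: (dominated_lim_cvg (C := 4)).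
- exact: l2_dominated.
- by apply: filterS hb => t; apply: l2_dominated.
- by move=> k; rewrite expr2; apply: cvgM; apply: cvgB => //; exact: cvg_cst.
Qed.

End MetricFilters.

(** * Tight spans of antipodal metrics *)

Section Antipodal.
Variables (R : realType) (X : Type) (d : X -> X -> R) (s : X -> X) (D : R).
Variable u : nat -> X.
Hypothesis d_sym : forall x y, d x y = d y x.
Hypothesis d_refl : forall x, d x x = 0.
Hypothesis d_ge0 : forall x y, 0 <= d x y.
Hypothesis d_tri : forall x y z, d x z <= d x y + d y z.
Hypothesis d_anti : forall x y, d x (s y) = D - d x y.
Hypothesis s_inv : involutive s.
Hypothesis D_gt0 : 0 < D.
(** Distance below [D] excludes antipodes, by [d_anti]. This independence up to sign yields
    [staircase], while the density in [u_net] makes a function of the tight span recoverable from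
    its samples. *)
Hypothesis u_indep : forall i j, (i < j)%N -> 0 < d (u i) (u j) < D.
Hypothesis u_net : forall e, 0 < e -> exists N, forall x, exists2 i, (i < N)%N &
  d x (u i) < e \/ d x (s (u i)) < e.

Lemma d_le x y : d x y <= D.
Proof. by have := d_ge0 x (s y); rewrite d_anti; lra. Qed.

Lemma d_ss x y : d (s x) (s y) = d x y.
Proof. by rewrite d_anti d_sym d_anti d_sym; ring. Qed.

(** Lowering [f] to [c] at the single point [x0] stays in [Delta], so minimality forbids a strict
    decrease. *)
Lemma tight_point f x0 c : tight_span d f -> 0 <= c -> c <= f x0 ->
  (forall x, d x0 x <= c + f x) -> f x0 = c.
Proof.
move=> [[[M fM] fd] fmin] c0 cf H.
pose g x := if `[< x = x0 >] then c else f x.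
have gx0 : g x0 = c by rewrite /g asboolT.
rewrite -gx0; congr (_ x0); apply/esym/fmin; last first.
  by move=> x; rewrite /g; case: asboolP => [->|].
split.
  exists (Num.max M c) => x; rewrite /g le_max; case: asboolP => _.
    by rewrite (ger0_norm c0) lexx orbT.
  by rewrite fM.
move=> x y; rewrite /g; case: asboolP => [->|_]; case: asboolP => [->|_] //.
- by rewrite d_refl addr_ge0.
- by rewrite d_sym addrC.
Qed.

(** Minimality is exploited through three values for [tight_point]: [D] bounds [f], [f y + d x y]
    gives the Lipschitz property, and [D - f (s x)] gives the antipodal sum. Conversely any smaller
    [g] satisfies [g x >= D - g (s x) >= D - f (s x) = f x]. *)
Lemma tight_spanP f : tight_span d f <->
  (forall x y, f x - f y <= d x y) /\ (forall x, f x + f (s x) = D).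
Proof.
split=> [tf|[lf af]]; last first.
  have fd x y : d x y <= f x + f y.
    by have := lf (s x) y; have := af x; rewrite d_sym d_anti d_sym; lra.
  have f0 x : 0 <= f x by have := fd x x; rewrite d_refl; lra.
  split; first split=> //.
    by exists D => x; rewrite ger0_norm //; have := af x; have := f0 (s x); lra.
  move=> g [_ gd] gf; apply/funext => x; apply/eqP; rewrite eq_le gf /=.
  by have := gd x (s x); have := af x; have := gf (s x); rewrite d_anti d_refl; lra.
have fd x y : d x y <= f x + f y by case: tf => [[_ fd] _].
have f0 x : 0 <= f x by have := fd x x; rewrite d_refl; lra.
have fD x : f x <= D.
  rewrite leNgt; apply/negP => Df; have := @tight_point f x D tf.
  suff H : forall y, d x y <= D + f y.
    by move=> /(_ (ltW D_gt0) (ltW Df) H) E; move: Df; rewrite E ltxx.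
  by move=> y; have := d_le x y; have := f0 y; lra.
have lf x y : f x - f y <= d x y.
  rewrite leNgt; apply/negP => lt; have := @tight_point f x (f y + d x y) tf.
  suff H : forall z, d x z <= f y + d x y + f z.
    have h1 : 0 <= f y + d x y by rewrite addr_ge0.
    have h2 : f y + d x y <= f x by lra.
    by move=> /(_ h1 h2 H); lra.
  by move=> z; have := d_tri x y z; have := fd y z; lra.
split=> // x; have := @tight_point f x (D - f (s x)) tf.
have h1 : 0 <= D - f (s x) by have := fD (s x); lra.
have h2 : D - f (s x) <= f x by have := fd x (s x); rewrite d_anti d_refl; lra.
move=> /(_ h1 h2) H; have -> : f x = D - f (s x); last by ring.
by apply: H => y; have := lf (s x) y; rewrite d_sym d_anti d_sym; lra.
Qed.

(** [D * a k] stands for the value at [u k] of the odd function [f - D / 2]; the conditions say that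
    its odd extension to the antipodes is 1-Lipschitz. Dividing by [D] places the samples in the
    cube, by the second condition at [i = j]. *)
Definition traces : set (nat -> R) := [set a | forall i j,
  D * (a i - a j) <= d (u i) (u j) /\ `|D * (a i + a j)| <= d (u i) (s (u j))].

Lemma traces_odd_lipschitz (h : X -> R) : (forall x y, h x - h y <= d x y) ->
  (forall x, h (s x) = - h x) -> traces (fun k => h (u k) / D).
Proof.
move=> lh oh i j; have D0 : D != 0 by rewrite gt_eqF.
rewrite -mulrBl -mulrDl ![D * _]mulrC !divfK //; split; first exact: lh.
have := lh (u i) (s (u j)); have := lh (s (u j)) (u i).
by rewrite oh [d (s _) _]d_sym => h1 h2; rewrite ler_norml; lra.
Qed.

(** The distance to the first [k] sample points and their antipodes, capped by [D]: an even
    1-Lipschitz function that vanishes at these points but not at [u k]. It localises the bump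
    needed for [staircase]. *)
Fixpoint net_dist k x : R := if k is k'.+1 then
  Num.min (net_dist k' x) (Num.min (d x (u k')) (d x (s (u k')))) else D.

Lemma min_lipschitz (a b a' b' e : R) : a - a' <= e -> b - b' <= e ->
  Num.min a b - Num.min a' b' <= e.
Proof.
move=> h1 h2; rewrite lerBlDr; have [le1|le1] := leP a' b'.
  by rewrite ge_min; apply/orP; left; lra.
by rewrite ge_min; apply/orP; right; lra.
Qed.

Lemma dist_lipschitz x y z : d x z - d y z <= d x y.
Proof. by have := d_tri x y z; lra. Qed.

Lemma net_dist_lipschitz k x y : net_dist k x - net_dist k y <= d x y.
Proof.
elim: k => [|k IH] /=; first by rewrite subrr.
by do 2 (apply: min_lipschitz => //; try exact: dist_lipschitz).
Qed.

Lemma net_dist_anti k x : net_dist k (s x) = net_dist k x.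
Proof.
elim: k => [//|k IH] /=; rewrite IH; congr Num.min.
have -> : d (s x) (u k) = d x (s (u k)) by rewrite -d_ss s_inv.
by rewrite d_ss minC.
Qed.

Lemma net_dist_ge0 k x : 0 <= net_dist k x.
Proof. by elim: k => [|k IH] /=; [exact: ltW|rewrite !le_min IH !d_ge0]. Qed.

Lemma net_dist0 k j : (j < k)%N -> net_dist k (u j) = 0.
Proof.
move=> jk; apply/le_anti; rewrite net_dist_ge0 andbT.
elim: k jk => [//|k IH] /=; rewrite ltnS leq_eqVlt => /predU1P[->|jk].
  by rewrite !ge_min d_refl lexx !orbT.
by rewrite ge_min IH.
Qed.

Lemma net_dist_gt0 k : 0 < net_dist k (u k).
Proof.
suff H j : (j <= k)%N -> 0 < net_dist j (u k) by exact: H.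
elim: j => [//|j IH] jk /=; rewrite !lt_min IH ?(ltnW jk) //=.
by have := u_indep jk; rewrite d_anti d_sym; lra.
Qed.

Lemma traces_body : body traces.
Proof.
split.
- apply: coord_closed_seq => b x tb bx i j; split.
    have lim : D * (b n i - b n j) @[n --> \oo] --> D * (x i - x j).
      by apply: cvgM; [exact: cvg_cst|exact: cvgB].
    by apply: (cvgr_to_le lim); apply: nearW => n; case: (tb n i j).
  have lim : `|D * (b n i + b n j)| @[n --> \oo] --> `|D * (x i + x j)|.
    by apply: cvg_norm; apply: cvgM; [exact: cvg_cst|exact: cvgD].
  by apply: (cvgr_to_le lim); apply: nearW => n; case: (tb n i j).
- move=> a ta i; have [_] := ta i i; rewrite d_anti d_refl subr0.
  rewrite normrM (gtr0_norm D_gt0) ger_pMr //.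
  by rewrite !ler_norml; lra.
- move=> a b l ta tb /andP[l0 l1] i j; have [a1 a2] := ta i j.
  have [b1 b2] := tb i j; have l1' : 0 <= 1 - l by lra.
  split.
    have -> : D * (l * a i + (1 - l) * b i - (l * a j + (1 - l) * b j)) =
      l * (D * (a i - a j)) + (1 - l) * (D * (b i - b j)) by ring.
    apply: le_trans (lerD (ler_wpM2l l0 a1) (ler_wpM2l l1' b1)) _.
    by rewrite -mulrDl addrC subrK mul1r.
  have -> : D * (l * a i + (1 - l) * b i + (l * a j + (1 - l) * b j)) =
    l * (D * (a i + a j)) + (1 - l) * (D * (b i + b j)) by ring.
  apply: le_trans (ler_normD _ _) _; rewrite normrM [`|(1 - l) * _|]normrM.
  rewrite (ger0_norm l0) (ger0_norm l1').
  apply: le_trans (lerD (ler_wpM2l l0 a2) (ler_wpM2l l1' b2)) _.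
  by rewrite -mulrDl addrC subrK mul1r.
- move=> a ta i j; have [_ a2] := ta i j; have [a1 _] := ta j i; split.
    by rewrite d_sym; apply: le_trans a1; rewrite opprK addrC.
  by rewrite -opprD mulrN normrN.
- move=> k.
  (* The antipode swaps the two minima, so [h] is odd, and halving their difference keeps it
     1-Lipschitz. Both minima vanish at the earlier sample points, but at [u k] only the second
     does. *)
  pose h x := (Num.min (net_dist k x) (d x (s (u k))) -
               Num.min (net_dist k x) (d x (u k))) / 2.
  have D0 : D != 0 by rewrite gt_eqF.
  exists (fun j => h (u j) / D).
    apply: traces_odd_lipschitz => [x y|x].
      have := min_lipschitz (net_dist_lipschitz k x y) (dist_lipschitz x y (s (u k))).
      have := net_dist_lipschitz k y x; have := dist_lipschitz y x (u k).
      by rewrite [d y x]d_sym => h1 h2; have := min_lipschitz h2 h1; rewrite /h; lra.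
    rewrite /h net_dist_anti d_ss.
    have -> : d (s x) (u k) = d x (s (u k)) by rewrite -d_ss s_inv.
    by ring.
  split=> [j jk|]; rewrite /h.
    by rewrite net_dist0 // !min_l ?d_ge0 // subrr !mul0r.
  rewrite d_anti d_refl subr0 (min_r (net_dist_ge0 _ _)) subr0.
  by rewrite !divr_gt0 // lt_min net_dist_gt0.
Qed.

Definition trace (f : X -> R) k : R := (f (u k) - D / 2) / D.

Lemma trace_in f : tight_span d f -> traces (trace f).
Proof.
move=> /tight_spanP[lf af]; apply: (traces_odd_lipschitz (h := fun x => f x - D / 2)).
  by move=> x y; have := lf x y; lra.
by move=> x; have := af x; lra.
Qed.

Let node (ib : nat * bool) : X := if ib.2 then s (u ib.1) else u ib.1.
Let node_val (a : nat -> R) (ib : nat * bool) : R :=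
  D / 2 + D * (if ib.2 then - a ib.1 else a ib.1).

Lemma node_val_lipschitz a p q : traces a ->
  node_val a p - node_val a q <= d (node p) (node q).
Proof.
move=> ta; case: p q => [i b] [j c]; rewrite /node_val /node /=.
have [a1 a2] := ta i j; have [a3 _] := ta j i; rewrite d_sym in a3.
move: a2; rewrite ler_norml => /andP[a2 a2'].
case: b; case: c; rewrite ?d_ss.
- by lra.
- by rewrite -[d (s _) _]d_ss s_inv; lra.
- by lra.
- by lra.
Qed.

(* McShane's extension, from the net and its antipodes. *)
Definition extend (a : nat -> R) (x : X) : R :=
  inf [set node_val a p + d x (node p) | p in setT].

Lemma extend_le a x p : traces a -> extend a x <= node_val a p + d x (node p).
Proof.
move=> ta; apply: ge_inf; last by exists p.
exists (node_val a p - d x (node p)) => _ [q _ <-].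
have := node_val_lipschitz p q ta; have := d_tri (node p) x (node q).
by rewrite [d (node p) x]d_sym; lra.
Qed.

Lemma extend_ge a x c : (forall p, c <= node_val a p + d x (node p)) -> c <= extend a x.
Proof.
move=> H; pose p0 := (0%N, true).
apply: lb_le_inf; first by exists (node_val a p0 + d x (node p0)), p0.
by move=> _ [q _ <-].
Qed.

Lemma extend_lipschitz a x y : traces a -> extend a x - extend a y <= d x y.
Proof.
move=> ta; rewrite lerBlDl -lerBlDr; apply: extend_ge => p.
by have := extend_le x p ta; have := d_tri x y (node p); lra.
Qed.

Lemma extend_node a p : traces a -> extend a (node p) = node_val a p.
Proof.
move=> ta; apply/le_anti/andP; split.
  by apply: le_trans (extend_le _ p ta) _; rewrite d_refl addr0.
by apply: extend_ge => q; have := node_val_lipschitz p q ta; lra.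
Qed.

Lemma near_node x e : 0 < e -> exists p, d x (node p) < e.
Proof.
move=> /u_net[N /(_ x)[i _ [H|H]]]; [by exists (i, false)|by exists (i, true)].
Qed.

(** At a node and its antipode the prescribed values add up to [D] exactly. A node within [e / 2] of
    [x] transfers this to [x] with error at most [e]. *)
Lemma extend_tight a : traces a -> tight_span d (extend a).
Proof.
move=> ta; apply/tight_spanP; split=> [x y|x]; first exact: extend_lipschitz.
apply/eqP; rewrite -subr_eq0 -normr_le0; apply/ler_addgt0Pr => e e0.
have e2 : 0 < e / 2 by lra.
have [[i b] /ltW xp] := near_node x e2.
have sp : s (node (i, b)) = node (i, ~~ b) by rewrite /node /=; case: b {xp}.
have sum : node_val a (i, b) + node_val a (i, ~~ b) = D.
  by rewrite /node_val /=; case: b {xp sp} => /=; lra.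
have sxp : d (s x) (node (i, ~~ b)) <= e / 2 by rewrite -sp d_ss.
have := extend_lipschitz x (node (i, b)) ta.
have := extend_lipschitz (node (i, b)) x ta.
have := extend_lipschitz (s x) (node (i, ~~ b)) ta.
have := extend_lipschitz (node (i, ~~ b)) (s x) ta.
rewrite !extend_node // [d (node (i, b)) x]d_sym [d (node _) (s x)]d_sym.
by rewrite add0r ler_norml => *; apply/andP; split; lra.
Qed.

Lemma trace_extend a : traces a -> trace (extend a) = a.
Proof.
move=> ta; apply/funext => k; rewrite /trace (extend_node (k, false) ta) /node_val /=.
by field; rewrite gt_eqF.
Qed.

Lemma trace_nodeE f p : tight_span d f -> f (node p) = node_val (trace f) p.
Proof.
move=> /tight_spanP[_ af]; case: p => i b; rewrite /node /node_val /trace /=.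
have D0 : D != 0 by rewrite gt_eqF.
by case: b; have := af (u i) => e; [have -> : f (s (u i)) = D - f (u i) by lra|];
  field.
Qed.

(** Passing from [x] to a nearby node costs [e] for each of [f] and [g], and at the node they differ
    by at most [e]. Finitely many samples thus control the sup-norm. *)
Lemma tight_dist_le f g e N : tight_span d f -> tight_span d g ->
  (forall x, exists2 i, (i < N)%N & d x (u i) <= e \/ d x (s (u i)) <= e) ->
  (forall i, (i < N)%N -> `|trace f i - trace g i| <= e / D) ->
  forall x, `|f x - g x| <= 3 * e.
Proof.
move=> tf tg HN Hi x; have [i iN Hx] := HN x.
have [p [xp pN]] : exists p, d x (node p) <= e /\ (p.1 < N)%N.
  by case: Hx => H; [exists (i, false)|exists (i, true)].
have /tight_spanP[lf _] := tf; have /tight_spanP[lg _] := tg.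
have : `|node_val (trace f) p - node_val (trace g) p| <= e.
  have -> : `|node_val (trace f) p - node_val (trace g) p| =
      D * `|trace f p.1 - trace g p.1|.
    rewrite -[D in RHS]gtr0_norm // -normrM /node_val; case: p.2.
      by rewrite -normrN; congr (`|_|); ring.
    by congr (`|_|); ring.
  by rewrite mulrC -ler_pdivlMr // Hi.
have := lf x (node p); have := lf (node p) x.
have := lg x (node p); have := lg (node p) x.
rewrite [d (node p) x]d_sym (trace_nodeE p tf) (trace_nodeE p tg).
by rewrite !ler_norml => h1 h2 h3 h4 /andP[h5 h6]; apply/andP; split; lra.
Qed.

Lemma extend_trace f : tight_span d f -> extend (trace f) = f.
Proof.
move=> tf; apply/funext => x; apply/eqP; rewrite -subr_eq0 -normr_le0.
apply/ler_addgt0Pr => e e0; rewrite add0r.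
have e3 : 0 < e / 3 by lra.
have te : tight_span d (extend (trace f)) by exact/extend_tight/trace_in.
have [N HN] := u_net e3.
have -> : e = 3 * (e / 3) by field.
apply: (@tight_dist_le _ _ (e / 3) N te tf).
  by move=> y; have [i iN H] := HN y; exists i => //; case: H => /ltW; [left|right].
move=> i _; rewrite trace_extend; last exact: trace_in.
by rewrite subrr normr0 divr_ge0 // ltW.
Qed.

Lemma supdist_ge f g x : tight_span d f -> tight_span d g ->
  `|f x - g x| <= supdist f g.
Proof.
move=> [[[M fM] _] _] [[[M' gM] _] _]; apply: ub_le_sup; last by exists x.
exists (M + M') => _ [y _ <-]; apply: le_trans (ler_normB _ _) _.
by apply: lerD.
Qed.

Lemma supdist_le (f g : X -> R) c : (forall x, `|f x - g x| <= c) -> supdist f g <= c.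
Proof.
by move=> H; apply: ge_sup => [|_ [y _ <-] //]; exists `|f (u 0%N) - g (u 0%N)|, (u 0%N).
Qed.

Lemma supdist_ge0 f g : tight_span d f -> tight_span d g -> 0 <= supdist f g.
Proof. by move=> tf tg; apply: le_trans (supdist_ge (u 0%N) tf tg). Qed.

Lemma supdist_cvg (T : Type) (F : set_system T) (b : T -> X -> R) f : Filter F ->
  tight_span d f -> (\forall t \near F, tight_span d (b t)) ->
  (forall k, trace (b t) k @[t --> F] --> trace f k) ->
  supdist f (b t) @[t --> F] --> 0.
Proof.
move=> FF tf tb bf; apply/cvgrPdist_le => e e0.
have e3 : 0 < e / 3 by lra.
have [N HN] := u_net e3.
have ed : 0 < e / 3 / D by rewrite divr_gt0.
have := near_prefix (k := N) FF ed (fun j _ => bf j).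
apply: filterS2 tb => t tb Ht; rewrite sub0r normrN ger0_norm ?supdist_ge0 //.
apply: supdist_le => x; have -> : e = 3 * (e / 3) by field.
apply: (@tight_dist_le _ _ (e / 3) N tf tb) => [y|i iN]; last exact/ltW/Ht.
by have [i iN H] := HN y; exists i => //; case: H => /ltW; [left|right].
Qed.

Lemma trace_cvg f k : tight_span d f ->
  trace g k @[g --> metric_nbhs (@supdist R X) (tight_span d) f] --> trace f k.
Proof.
move=> tf; have FF := metric_nbhs_filter (@supdist R X) (tight_span d) f.
apply: cvgM; last exact: cvg_cst; apply: cvgB; last exact: cvg_cst.
apply: (metric_nbhs_cvg (g := fun g => g (u k))) => g tg.
exact: supdist_ge.
Qed.

Lemma antipodal_homeomorphic : homeomorphic (tight_span d) (@supdist R X)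
  (@hilbert_cube R) (@l2dist R).
Proof.
have [phi [psi [[phiH psiK phiK psiKK] [cphi cpsi]]]] :=
  body_homeo traces_body (hilbert_cube_body R).
exists (fun f => phi (trace f)), (fun q => extend (psi q)).
split; first by move=> f /trace_in/phiH.
split; first by move=> q /psiK/extend_tight.
split; first by move=> f tf; rewrite phiK ?extend_trace //; apply: trace_in.
split; first by move=> q hq; rewrite trace_extend ?psiKK //; apply: psiK.
split; apply: metric_continuous_cvg.
  move=> f tf; have FF := metric_nbhs_filter (@supdist R X) (tight_span d) f.
  have nf := metric_nbhs_in (@supdist R X) (tight_span d) f.
  apply: l2dist_cvg => [||k].
  - exact/phiH/trace_in.
  - by apply: filterS nf => g /trace_in/phiH.
  - apply: cphi.
    + exact: trace_in.
    + by apply: filterS nf => g; apply: trace_in.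
    + by move=> j; apply: trace_cvg.
move=> q hq; have FF := metric_nbhs_filter (@l2dist R) (@hilbert_cube R) q.
have nq := metric_nbhs_in (@l2dist R) (@hilbert_cube R) q.
apply: supdist_cvg => [||k].
- exact/extend_tight/psiK.
- by apply: filterS nq => a /psiK/extend_tight.
- rewrite trace_extend; last exact: psiK.
  have cv : psi a k @[a --> metric_nbhs (@l2dist R) (@hilbert_cube R) q] --> psi q k.
    apply: cpsi => // j; apply: (metric_nbhs_cvg (g := fun a => a j)) => a ha.
    exact: l2dist_coord.
  apply: cvg_trans cv; apply: near_eq_cvg; apply: filterS nq => a ha.
  by rewrite trace_extend //; apply: psiK.
Qed.

End Antipodal.

(** * The round sphere *)

Section Sphere.
Variables (R : realType) (n : nat).
Implicit Types (x y z : sphere R n) (v w : 'rV[R]_n.+1).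

Definition dot v w : R := \sum_(i < n.+1) v ord0 i * w ord0 i.

Lemma dotC v w : dot v w = dot w v.
Proof. by apply: eq_bigr => i _; rewrite mulrC. Qed.

Lemma dotDl v v' w : dot (v + v') w = dot v w + dot v' w.
Proof. by rewrite -big_split; apply: eq_bigr => i _; rewrite mxE mulrDl. Qed.

Lemma dotZl a v w : dot (a *: v) w = a * dot v w.
Proof. by rewrite mulr_sumr; apply: eq_bigr => i _; rewrite mxE mulrA. Qed.

Lemma dotNl v w : dot (- v) w = - dot v w.
Proof. by rewrite -scaleN1r dotZl mulN1r. Qed.

Lemma dotDr v w w' : dot v (w + w') = dot v w + dot v w'.
Proof. by rewrite dotC dotDl !(dotC v). Qed.

Lemma dotZr a v w : dot v (a *: w) = a * dot v w.
Proof. by rewrite dotC dotZl dotC. Qed.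

Lemma dotNr v w : dot v (- w) = - dot v w.
Proof. by rewrite dotC dotNl dotC. Qed.

Definition dotE := (dotDl, dotDr, dotZl, dotZr, dotNl, dotNr).

Lemma dot_ge0 v : 0 <= dot v v.
Proof. by apply: sumr_ge0 => i _; rewrite -expr2 sqr_ge0. Qed.

Lemma dot_eq0 v : dot v v = 0 -> v = 0.
Proof.
move=> /eqP; rewrite psumr_eq0 => [/allP H|i _]; last by rewrite -expr2 sqr_ge0.
apply/rowP => i; have := H i (mem_index_enum _).
by rewrite mulf_eq0 orbb mxE => /eqP.
Qed.

Lemma cauchy_schwarz v w : dot v w ^+ 2 <= dot v v * dot w w.
Proof.
have [w0|w0] := eqVneq (dot w w) 0.
  have -> : dot v w = 0 by rewrite (dot_eq0 w0) -(scale0r 0) dotZr mul0r.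
  by rewrite w0 mulr0 expr0n.
have {}w0 : 0 < dot w w by rewrite lt_neqAle eq_sym w0 dot_ge0.
have := dot_ge0 (dot w w *: v - dot v w *: w).
have -> : dot (dot w w *: v - dot v w *: w) (dot w w *: v - dot v w *: w) =
    dot w w * (dot v v * dot w w - dot v w ^+ 2).
  by rewrite !dotE (dotC w v); ring.
by rewrite pmulr_rge0 // subr_ge0.
Qed.

Lemma sphere_dot x : dot (sval x) (sval x) = 1.
Proof. by case: x => v v1 /=; rewrite -[RHS]v1; apply: eq_bigr => i _; rewrite expr2. Qed.

Lemma gdistE x y : gdist x y = acos (dot (sval x) (sval y)). Proof. by []. Qed.

Lemma dot_sphere_le1 x y : -1 <= dot (sval x) (sval y) <= 1.
Proof.
have := cauchy_schwarz (sval x) (sval y); rewrite !sphere_dot mulr1.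
by rewrite -ler_norml -[_ ^+ 2]real_normK ?num_real // expr_le1.
Qed.

Lemma sphere_mkP v : dot v v = 1 -> \sum_(i < n.+1) v ord0 i ^+ 2 = 1.
Proof. by move=> <-; apply: eq_bigr => i _; rewrite expr2. Qed.

Definition sphere_mk v (v1 : dot v v = 1) : sphere R n :=
  exist (fun v : 'rV[R]_n.+1 => \sum_(i < n.+1) v ord0 i ^+ 2 = 1) v (sphere_mkP v1).

Lemma dotNN v : dot v v = 1 -> dot (- v) (- v) = 1.
Proof. by rewrite dotNl dotNr opprK. Qed.

Definition antipode x : sphere R n := sphere_mk (dotNN (sphere_dot x)).

Lemma sphere_inj x y : sval x = sval y -> x = y.
Proof.
case: x y => [v Hv] [w Hw] /= vw; subst w; congr exist; exact: Prop_irrelevance.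
Qed.

Lemma antipodeK : involutive antipode.
Proof. by move=> x; apply: sphere_inj; rewrite /= opprK. Qed.

Lemma gdist_sym x y : gdist x y = gdist y x.
Proof. by rewrite !gdistE dotC. Qed.

Lemma gdist_refl x : gdist x x = 0.
Proof. by rewrite gdistE sphere_dot acos1. Qed.

Lemma gdist_ge0 x y : 0 <= gdist x y.
Proof. by rewrite gdistE acos_ge0 // dot_sphere_le1. Qed.

Lemma gdist_lepi x y : gdist x y <= pi.
Proof. by rewrite gdistE acos_lepi // dot_sphere_le1. Qed.

Lemma gdist_antipode x y : gdist x (antipode y) = pi - gdist x y.
Proof. by rewrite !gdistE dotNr acosN // dot_sphere_le1. Qed.

Lemma cos_gdist x y : cos (gdist x y) = dot (sval x) (sval y).
Proof. by rewrite gdistE acosK // in_itv /= dot_sphere_le1. Qed.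

Lemma sin_gdist_ge0 x y : 0 <= sin (gdist x y).
Proof. by apply: sin_ge0_pi; rewrite gdist_ge0 gdist_lepi. Qed.

(* Project [x] and [z] orthogonally to [y] and apply Cauchy-Schwarz: this gives
   [<x, z> >= cos (d x y + d y z)]. *)
Lemma gdist_triangle x y z : gdist x z <= gdist x y + gdist y z.
Proof.
have [le_pi|lt_pi] := leP pi (gdist x y + gdist y z).
  exact: le_trans (gdist_lepi x z) le_pi.
rewrite leNgt; apply/negP => lt.
have sum_itv : gdist x y + gdist y z \in `[0, pi].
  by rewrite in_itv /= addr_ge0 ?gdist_ge0 // ltW.
have xz_itv : gdist x z \in `[0, pi] by rewrite in_itv /= gdist_ge0 gdist_lepi.
move: lt; rewrite -ltr_cos //; apply/negP; rewrite -leNgt cosD !cos_gdist.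
have s1 := sin_gdist_ge0 x y; have s2 := sin_gdist_ge0 y z.
have := cos2Dsin2 (gdist x y); have := cos2Dsin2 (gdist y z).
rewrite !cos_gdist => h1 h2.
have := cauchy_schwarz (sval x - dot (sval x) (sval y) *: sval y)
  (sval z - dot (sval y) (sval z) *: sval y).
move: (sphere_dot x) (sphere_dot y) (sphere_dot z) => xx yy zz.
have -> : dot (sval x - dot (sval x) (sval y) *: sval y)
    (sval x - dot (sval x) (sval y) *: sval y) = sin (gdist x y) ^+ 2.
  rewrite !dotE xx yy (dotC (sval y) (sval x)).
  by rewrite -[X in _ = X](addKr (dot (sval x) (sval y) ^+ 2)) h2; ring.
have -> : dot (sval z - dot (sval y) (sval z) *: sval y)
    (sval z - dot (sval y) (sval z) *: sval y) = sin (gdist y z) ^+ 2.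
  rewrite !dotE zz yy (dotC (sval z) (sval y)).
  by rewrite -[X in _ = X](addKr (dot (sval y) (sval z) ^+ 2)) h1; ring.
have -> : dot (sval x - dot (sval x) (sval y) *: sval y)
    (sval z - dot (sval y) (sval z) *: sval y) =
    dot (sval x) (sval z) - dot (sval x) (sval y) * dot (sval y) (sval z).
  by rewrite !dotE yy; ring.
move: (sin _) (sin _) (dot (sval x) (sval z)) s1 s2 {h1 h2} => b a r s1 s2.
move: (dot _ _) (dot _ _) => p q.
rewrite -exprMn => H.
have ab0 : 0 <= a * b by rewrite mulr_ge0.
have : `|r - q * p| <= a * b.
  by rewrite -(@ler_pXn2r _ 2) ?nnegrE // real_normK ?num_real.
by rewrite ler_norml => /andP[+ _]; lra.
Qed.

Lemma dot1_eq x y : dot (sval x) (sval y) = 1 -> sval x = sval y.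
Proof.
move=> e; apply/eqP; rewrite -subr_eq0; apply/eqP/dot_eq0.
by rewrite !dotE !sphere_dot (dotC (sval y)) e; ring.
Qed.

Lemma gdist_lt x y e : 0 <= e -> e <= pi -> cos e < dot (sval x) (sval y) ->
  gdist x y < e.
Proof.
move=> e0 epi H; rewrite -ltr_cos ?cos_gdist //; last by rewrite in_itv /= e0.
by rewrite in_itv /= gdist_ge0 gdist_lepi.
Qed.

(** Rational points of the affine chart where coordinate 0 equals 1. Normalised, they lie in an open
    hemisphere, so no two are antipodal, and they are dense there, hence dense in the sphere up to
    sign. *)
Definition affine_vec (q : 'rV[rat]_n) : 'rV[R]_n.+1 :=
  \row_i (if unlift ord0 i is Some j then ratr (q ord0 j) else 1).

Lemma affine_vec0 q : affine_vec q ord0 ord0 = 1.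
Proof. by rewrite mxE unlift_none. Qed.

Lemma affine_vec_norm q : 0 < dot (affine_vec q) (affine_vec q).
Proof.
rewrite lt_neqAle dot_ge0 andbT; apply/eqP => /esym/dot_eq0/rowP/(_ ord0).
by rewrite affine_vec0 mxE => /eqP; rewrite oner_eq0.
Qed.

Definition affine_norm q : R := Num.sqrt (dot (affine_vec q) (affine_vec q)).

Lemma affine_norm_gt0 q : 0 < affine_norm q.
Proof. by rewrite sqrtr_gt0 affine_vec_norm. Qed.

Lemma affine_unit q :
  dot ((affine_norm q)^-1 *: affine_vec q) ((affine_norm q)^-1 *: affine_vec q) = 1.
Proof.
rewrite !dotE mulrA -invfM -expr2 sqr_sqrtr ?mulVf ?ltW ?affine_vec_norm //.
by rewrite gt_eqF // affine_vec_norm.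
Qed.

Definition affine_pt q : sphere R n := sphere_mk (affine_unit q).

Lemma affine_pt_inj q q' : sval (affine_pt q) = sval (affine_pt q') -> q = q'.
Proof.
move=> /= /rowP e; have := e ord0; rewrite !mxE !unlift_none !mulr1 => /invr_inj e0.
apply/rowP => j; apply: (fmorph_inj (ratr : rat -> R)).
have := e (lift ord0 j); rewrite !mxE !liftK e0.
by apply: mulfI; rewrite invr_neq0 // gt_eqF // affine_norm_gt0.
Qed.

Lemma affine_pt_antipode q q' : sval (affine_pt q) <> - sval (affine_pt q').
Proof.
move=> /rowP/(_ ord0); rewrite /= !mxE !unlift_none !mulr1 => e.
have : 0 < (affine_norm q)^-1 by rewrite invr_gt0 affine_norm_gt0.
have : 0 < (affine_norm q')^-1 by rewrite invr_gt0 affine_norm_gt0.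
by rewrite e; lra.
Qed.

Lemma affine_pt_indep q q' : q <> q' -> 0 < gdist (affine_pt q) (affine_pt q') < pi.
Proof.
move=> qq; have := dot_sphere_le1 (affine_pt q) (affine_pt q').
set t := dot _ _ => /andP[t1 t2]; have tn1 : t != 1.
  by apply/eqP => /dot1_eq/affine_pt_inj.
have tnN1 : t != -1.
  apply/eqP => e; apply: (@affine_pt_antipode q q').
  have /dot1_eq -> // : dot (sval (affine_pt q)) (sval (antipode (affine_pt q'))) = 1.
  by rewrite dotNr -/t e opprK.
rewrite gdistE acos_gt0 ?acos_ltpi // -/t ?t1 ?t2 ?andbT /=.
  by rewrite lt_neqAle eq_sym tnN1.
by rewrite lt_neqAle tn1.
Qed.

(* [x] is approximated by [(x_0 + t) (1, q)] with [q] rational and [t] small. *)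
Lemma affine_pt_dense_half x c : 0 <= c < 1 -> 0 <= sval x ord0 ord0 ->
  exists q, c < dot (sval x) (sval (affine_pt q)).
Proof.
move=> /andP[c0 c1] x0; pose m : R := n.+1%:R; have m1 : 1 <= m by rewrite ler1n.
(* The estimates below give [1 - m * t <= dot (sval x) y] and norm of [y] at most [1 + m * t]; the
   choice of [t] makes [c * (1 + m * t) < 1 - m * t]. *)
have [t t0 mt] : exists2 t, 0 < t & m * t = (1 - c) / 3.
  exists ((1 - c) / (3 * m)); first by rewrite divr_gt0 //; lra.
  by field; lra.
have mt0 : 0 <= m * t by rewrite mt; lra.
(* Adding [t] keeps the scale positive for [x] on the equator. *)
pose l := sval x ord0 ord0 + t; have l0 : 0 < l by rewrite /l; lra.
have /choice[q Hq] : forall j : 'I_n, exists r : rat,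
    `|sval x ord0 (lift ord0 j) - l * ratr r| <= t.
  move=> j; set a := sval x _ _.
  have /rat_in_itvoo[r] : (a - t) / l < (a + t) / l by rewrite ltr_pM2r ?invr_gt0 //; lra.
  rewrite in_itv /= ltr_pdivrMr // ltr_pdivlMr // => /andP[h1 h2].
  by exists r; rewrite ler_norml [l * _]mulrC; lra.
exists (\row_j q j); set qq := \row_j q j; set y := l *: affine_vec qq.
have [w wE] : exists w, w = y - sval x by eexists.
have w_le i : `|w ord0 i| <= t.
  rewrite wE /y; have [j ->|->] := unliftP ord0 i.
    by rewrite !mxE liftK mxE distrC.
  by rewrite !mxE unlift_none mulr1 /l addrAC subrr add0r ger0_norm // ltW.
have y_x : y = sval x + w by rewrite wE addrC subrK.
have ww : dot w w <= m * t ^+ 2.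
  rewrite /m -[n.+1 in leRHS]card_ord mulr_natl -sumr_const ler_sum // => i _.
  by rewrite -expr2 -real_normK ?num_real // lerXn2r ?nnegrE // ltW.
have xw : `|dot (sval x) w| <= m * t.
  rewrite -(@ler_pXn2r _ 2) ?nnegrE //.
  rewrite real_normK ?num_real //; apply: le_trans (cauchy_schwarz _ _) _.
  rewrite sphere_dot mul1r; apply: le_trans ww _.
  by rewrite exprMn ler_wpM2r ?sqr_ge0 // expr2 ler_peMl //; lra.
have yy : dot y y <= (1 + m * t) ^+ 2.
  have -> : dot y y = 1 + 2 * dot (sval x) w + dot w w.
    by rewrite y_x !dotE sphere_dot (dotC w); ring.
  have h : m * t ^+ 2 <= (m * t) ^+ 2.
    by rewrite exprMn ler_wpM2r ?sqr_ge0 // expr2 ler_peMl //; lra.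
  by move: xw; rewrite ler_norml => /andP[_ h2]; nra.
have xy : 1 - m * t <= dot (sval x) y.
  by rewrite y_x dotDr sphere_dot; move: xw; rewrite ler_norml => /andP[h _]; lra.
have ny : l * affine_norm qq <= 1 + m * t.
  have h1 : 0 <= l * affine_norm qq by rewrite mulr_ge0 // ltW // affine_norm_gt0.
  have h2 : 0 <= 1 + m * t by rewrite addr_ge0.
  rewrite -(@ler_pXn2r _ 2) ?nnegrE //.
  apply: le_trans yy; rewrite exprMn sqr_sqrtr ?dot_ge0 // /y !dotE.
  by rewrite expr2 mulrA.
rewrite /= dotZr mulrC ltr_pdivlMr ?affine_norm_gt0 //.
rewrite -(ltr_pM2l l0) -(dotZr l) -/y; apply: lt_le_trans xy.
rewrite mulrCA; apply: le_lt_trans (ler_wpM2l c0 ny) _.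
by rewrite mt; nra.
Qed.

Lemma affine_pt_dense x c : 0 <= c < 1 ->
  exists q, c < `|dot (sval x) (sval (affine_pt q))|.
Proof.
move=> c01; have [x0|x0] := leP 0 (sval x ord0 ord0).
  have [q Hq] := affine_pt_dense_half c01 x0; exists q.
  by apply: lt_le_trans Hq (ler_norm _).
have [|q Hq] := affine_pt_dense_half (x := antipode x) c01.
  by rewrite /= mxE oppr_ge0 ltW.
exists q; rewrite -normrN -dotNl; apply: lt_le_trans Hq (ler_norm _).
Qed.

Lemma dot_cvg (T : Type) (F : set_system T) (b b' : T -> 'rV[R]_n.+1) v w : Filter F ->
  (forall i, b t ord0 i @[t --> F] --> v ord0 i) ->
  (forall i, b' t ord0 i @[t --> F] --> w ord0 i) ->
  dot (b t) (b' t) @[t --> F] --> dot v w.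
Proof.
move=> FF bv bw; apply: cvg_big => [|i _]; last exact: cvgM.
by move=> ? ?; apply: add_continuous.
Qed.

Lemma dot_continuous w : continuous (fun v => dot v w).
Proof.
move=> v; apply: (@dot_cvg _ (nbhs v) id (fun=> w)) => i; last exact: cvg_cst.
exact: coord_continuous.
Qed.

Lemma dot_diag_continuous : continuous (fun v => dot v v).
Proof.
by move=> v; apply: (@dot_cvg _ (nbhs v) id id) => i; exact: coord_continuous.
Qed.

Lemma sphere_compact : compact [set v : 'rV[R]_n.+1 | dot v v = 1].
Proof.
apply: (@subclosed_compact _ _
    [set v : 'rV[R]_n.+1 | forall i, `[(-1 : R), 1]%classic (v ord0 i)]).
- apply: (preimage_closed (f := fun v : 'rV[R]_n.+1 => dot v v) (D := [set 1])).
    by move=> v _; exact: dot_diag_continuous.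
  exact: closed_eq.
- by apply: (@rV_compact _ _ (fun=> `[(-1 : R), 1]%classic)) => i; apply: segment_compact.
- move=> v v1 i; rewrite /= in_itv /= -ler_norml.
  rewrite -(@expr_le1 _ 2) // real_normK ?num_real // -v1 /dot (bigD1 i) //=.
  by rewrite expr2 lerDl sumr_ge0 // => j _; rewrite -expr2 sqr_ge0.
Qed.

Lemma affine_pt_net (u : nat -> 'rV[rat]_n) e : (forall q, exists k, u k = q) -> 0 < e ->
  exists N, forall x, exists2 i, (i < N)%N &
    gdist x (affine_pt (u i)) < e \/ gdist x (antipode (affine_pt (u i))) < e.
Proof.
(* Up to [pi / 2] the cosine is nonnegative, so the condition on the absolute value of the dot
   product describes the union of two opposite caps of radius [e']. *)
move=> u_surj e0; pose e' := Num.min e (pi / 2).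
have pi0 := pi_gt0 R.
have [e'0 e'e e'pi] : [/\ 0 < e', e' <= e & e' <= pi / 2].
  by rewrite /e' lt_min e0 !ge_min !lexx orbT; split => //; lra.
have c01 : 0 <= cos e' < 1.
  rewrite cos_ge0_pihalf ?e'pi ?andbT /=; last lra.
  by rewrite -[ltRHS]cos0 ltr_cos // in_itv /= ?lexx ?ltW //=; lra.
pose O (i : nat) := [set v : 'rV[R]_n.+1 | cos e' < `|dot v (sval (affine_pt (u i)))|].
have := sphere_compact; rewrite compact_cover => /(_ nat setT O).
case.
- move=> i _; rewrite /O.
  apply: (@open_comp _ _ (fun v : 'rV[R]_n.+1 => `|dot v (sval (affine_pt (u i)))|)
    [set t | cos e' < t]); last exact: open_gt.
  by move=> v _; exact: (cvg_norm (@dot_continuous (sval (affine_pt (u i))) v)).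
- move=> v v1; have [q Hq] := affine_pt_dense (sphere_mk v1) c01.
  by have [k uk] := u_surj q; exists k => //; rewrite /O /= uk.
move=> E _ cov; exists (\max_(i <- finmap.enum_fset E) i).+1 => x.
have [i /= iE Hi] := cov (sval x) (sphere_dot x).
exists i; first by rewrite ltnS leq_bigmax_seq.
have [t0|t0] := leP 0 (dot (sval x) (sval (affine_pt (u i)))).
  left; apply: lt_le_trans e'e; apply: gdist_lt; [exact: ltW|lra|].
  by move: Hi; rewrite /O /= ger0_norm.
right; apply: lt_le_trans e'e; apply: gdist_lt; [exact: ltW|lra|].
by move: Hi; rewrite /O /= dotNr ltr0_norm.
Qed.

(** Surjectivity is for density, and injectivity because distinct indices must give distinct points.
    The constant rows provide infinitely many elements, which takes a positive [n]. *)
Lemma rat_row_enum : (0 < n)%N -> exists u : nat -> 'rV[rat]_n,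
  injective u /\ forall q, exists k, u k = q.
Proof.
move=> n0; have /card_set_bijP[f [_ finj fsurj]] : ([set: 'rV[rat]_n] #= [set: nat])%card.
  apply/card_eqPle; split; first exact: countableP.
  have /injfunPex[h] : exists2 f : nat -> 'rV[rat]_n,
      set_fun [set: nat] [set: 'rV[rat]_n] f & set_inj [set: nat] f.
    exists (fun k => const_mx k%:R) => // i j _ _ /rowP/(_ (Ordinal n0)).
    by rewrite !mxE => /eqP; rewrite eqr_nat => /eqP.
  exact: inj_card_le h.
have /choice[u Hu] : forall k, exists q, f q = k.
  by move=> k; have [q _ <-] := fsurj k I; exists q.
exists u; split=> [i j uij|q]; first by rewrite -(Hu i) -(Hu j) uij.
by exists (f q); apply: finj; rewrite ?inE // Hu.
Qed.

End Sphere.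
Unset Implicit Arguments.

Theorem theorem3p11 (R : realType) (n : nat) (hn : (0 < n)%N) :
  homeomorphic (tight_span (@gdist R n)) (@supdist R (sphere R n))
               (@hilbert_cube R) (@l2dist R).
Proof.
have [u [u_inj u_surj]] := rat_row_enum hn.
apply: (@antipodal_homeomorphic R _ (@gdist R n) (@antipode R n) pi
  (fun k => affine_pt R (u k))).
- exact: gdist_sym.
- exact: gdist_refl.
- exact: gdist_ge0.
- exact: gdist_triangle.
- exact: gdist_antipode.
- exact: antipodeK.
- exact: pi_gt0.
- by move=> i j ij; apply: affine_pt_indep => /u_inj e; rewrite e ltnn in ij.
- by move=> e e0; apply: affine_pt_net.
Qed.
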